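(* Let $X$ be a compact Hausdorff space and let $\mathcal A\subseteq C(X)$ be a uniform logmodular subalgebra. Then for every $n$ and every $(f_{i,j})$ in the open unit ball of $M_n(\mathcal A)$, there exist an integer $m$, scalar matrices $C_0,\ldots,C_m$ (of appropriate sizes) all with norm less than one, and block diagonal matrices $D_1,\ldots,D_m$ (of appropriate sizes) whose direct summands are elements of the open unit ball of either $M_{2,1}(\mathcal A)$ or $M_{1,2}(\mathcal A)$, such that $$(f_{i,j})=C_0D_1C_1\cdots D_mC_m.$$
   Context: $C(X)$ is the C*-algebra of continuous complex-valued functions on $X$ with the supremum norm, and $C_{\mathbb R}(X)$ is the set of real-valued functions in $C(X)$. For a unital subalgebra $\mathcal A\subseteq C(X)$, $\mathcal A^{-1}$ denotes the set of elements of $\mathcal A$ that are invertible with inverse in $\mathcal A$. $\mathcal A$ is a (uniform) logmodular subalgebra of $C(X)$ if $\{\log|a| : a\in\mathcal A^{-1}\}$ is uniformly dense in $C_{\mathbb R}(X)$; equivalently, $\{|a|^2: a\in\mathcal A^{-1}\}$ is dense in the set of positive invertible functions in $C(X)$. $M_{p,q}(\mathcal A)$ is normed as a subspace of $M_{p,q}(C(X))$, i.e. $\|(f_{i,j})\|=\sup_{x\in X}\|(f_{i,j}(x))\|$ with the operator norm on $M_{p,q}(\mathbb C)$. Scalar matrices are matrices with complex entries, with the operator norm. ''Appropriate sizes'' means simply that the sizes are such that the product is defined (and has the size of the left-hand side). *)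

(* Defs.v *)
From mathcomp Require Import all_boot all_order all_algebra.
From mathcomp Require Import all_classical all_reals all_analysis.
From mathcomp Require Export complex.

Set Implicit Arguments.
Unset Strict Implicit.
Unset Printing Implicit Defensive.

Import Order.TTheory GRing.Theory Num.Theory.
Import numFieldNormedType.Exports.

Local Open Scope classical_set_scope.
Local Open Scope complex_scope.
Local Open Scope ring_scope.

(* The regular algebra R[i]^o carries the topology given by the modulus. *)
Definition cfun (R : realType) (X : topologicalType) : set (X -> R[i]) :=
  [set f | continuous (f : X -> R[i]^o)].

Definition unital_subalgebra (R : realType) (X : topologicalType)
    (A : set (X -> R[i])) : Prop :=
  [/\ A `<=` @cfun R X,
      A 1,
      (forall (c : R[i]) f g, A f -> A g -> A (c *: f + g))
    & (forall f g, A f -> A g -> A (f * g))].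

Definition invertibles (R : realType) (X : topologicalType)
    (A : set (X -> R[i])) : set (X -> R[i]) :=
  [set a | A a /\ exists2 b, A b & a * b = 1].

(* No norm-closedness is imposed on A. *)
Definition logmodular (R : realType) (X : topologicalType)
    (A : set (X -> R[i])) : Prop :=
  unital_subalgebra A /\
  [set u : X -> R | continuous u] `<=`
    closure ([set (fun x => ln (Normc.normc (a x))) | a in invertibles A]
             : set {uniform X -> R}).

Definition l2norm (R : realType) (n : nat) (v : 'cV[R[i]]_n) : R :=
  Num.sqrt (\sum_(i < n) Normc.normc (v i ord0) ^+ 2).

Definition opnorm (R : realType) (p q : nat) (M : 'M[R[i]]_(p, q)) : R :=
  sup [set l2norm (M *m v) | v in [set v | l2norm v <= 1]].

(* [sup] of an unbounded set is 0, so this is the supremum norm only for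
   matrices with bounded entries; it is used below on continuous entries over
   a compact space. *)
Definition mxnorm (R : realType) (X : topologicalType) (p q : nat)
    (F : 'M[X -> R[i]]_(p, q)) : R :=
  sup (range (fun x : X => opnorm (map_mx (fun f => f x) F))).

Definition mxball (R : realType) (X : topologicalType) (A : set (X -> R[i]))
    (p q : nat) : set 'M[X -> R[i]]_(p, q) :=
  [set F : 'M[X -> R[i]]_(p, q) | (forall i j, A (F i j)) /\ mxnorm F < 1].

(* Summands of both shapes may occur in the same matrix. *)
Inductive block_diag (R : realType) (X : topologicalType)
    (A : set (X -> R[i])) :
    forall p q : nat, 'M[X -> R[i]]_(p, q) -> Prop :=
| block_diag_col (D : 'M[X -> R[i]]_(2, 1)) :
    mxball A D -> block_diag A D
| block_diag_row (D : 'M[X -> R[i]]_(1, 2)) :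
    mxball A D -> block_diag A D
| block_diag_sum (p1 q1 p2 q2 : nat)
    (D1 : 'M[X -> R[i]]_(p1, q1)) (D2 : 'M[X -> R[i]]_(p2, q2)) :
    block_diag A D1 -> block_diag A D2 ->
    block_diag A (block_mx D1 0 0 D2).

Definition scalar_cst (R : realType) (X : topologicalType) (p q : nat)
    (C : 'M[R[i]]_(p, q)) : 'M[X -> R[i]]_(p, q) :=
  map_mx (fun c => cst c) C.

(* C 0 *m D 0 *m C 1 *m ... *m D (m - 1) *m C m; the D's are numbered from 0,
   and the matrices of larger index are irrelevant. *)
Fixpoint alt_prod (R : realType) (X : topologicalType) (r c : nat -> nat)
    (C : forall k, 'M[R[i]]_(r k, c k))
    (D : forall k, 'M[X -> R[i]]_(c k, r k.+1)) (m : nat) :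
    'M[X -> R[i]]_(r 0%N, c m) :=
  match m return 'M[X -> R[i]]_(r 0%N, c m) with
  | 0%N => scalar_cst X (C 0%N)
  | k.+1 => alt_prod C D k *m D k *m scalar_cst X (C k.+1)
  end.

(* Main.v *)
Require Import Defs.
From mathcomp Require Import all_boot all_order all_algebra.
From mathcomp Require Import all_classical all_reals all_analysis.
From mathcomp Require Import complex.
From mathcomp Require Import ring lra.

Set Implicit Arguments.
Unset Strict Implicit.
Unset Printing Implicit Defensive.

Import Order.TTheory GRing.Theory Num.Theory.
Import numFieldNormedType.Exports.

Local Open Scope classical_set_scope.
Local Open Scope complex_scope.
Local Open Scope ring_scope.

(** Call a matrix over [A] good if it is obtained from scalar contractions and
    from contractive columns of length two and rows of length two by products and
    direct sums.  A good matrix multiplied by a scalar below one is an alternating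
    product of the required kind ([good_factorized], [factorized_alt_prod]), so
    the content of the theorem is [good_of_contraction]: a matrix [F] over [A]
    that is contractive at every point is, up to a factor as close to one as one
    likes, good.

    Abstractly this holds because a unital homomorphism [rho] of [A] into
    operators that is contractive on short columns and rows is completely
    contractive: [|a|^2 |-> rho(a)^* rho(a)] is superadditive because of columns
    and subadditive to first order at the constant 1 because of rows, so its
    derivative there is a positive linear map on the continuous functions that
    extends [rho], and a positive map on a commutative algebra is completely
    positive.  The proof below follows this argument without Hilbert spaces.

    The vectors of the Hilbert space are replaced by rows over [A], and an
    operator inequality [rho(G)^* rho(G) <= rho(H)^* rho(H)] by the relation
    [G = g H] with [g] good.  What a matrix [H] over [A] keeps of its norm is the
    Gram kernel [H(x)^* H(y)] on [X * X]: it determines [H] up to a scalar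
    contraction ([lurking_isometry]), so the relation descends to an order on
    kernels ([lek]), and all linear algebra becomes identities between functions
    of two points.  The order has a cancellation law ([lek_cancel]): if
    [k + f <= k + g] then [k + N f <= k + N g] for all [N], and dividing by [N]
    makes [k] negligible.  Hence it suffices to show that the formal difference of
    a multiple, close to 1, of the unit kernel and of the Gram kernel of [F] is
    nonnegative ([good_of_posk]).

    For this take a partition of unity [phi_j] on whose pieces [F] is nearly
    constant, a small [e], and invertible [c_j] in [A] with [|c_j|^2] close to
    [1 + e phi_j]; they exist by logmodularity.  The forms
    [T_j(z) = |c_j z|^2 - |z|^2] play the role of [e] times the positive map at
    [phi_j].  They are nonnegative, their sum is at most about [e |z|^2]
    ([testk_sum], columns), and [e Re<f z, z>] is bounded by
    [sum_j Re(f(x_j)) T_j(z)] up to small multiples of [e |z|^2] ([testk_upper],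
    rows).  Polarizing over the entries of [F] reduces contractivity of [F] to
    contractivity of the scalar matrices [F(x_j)]. *)

(** * Complex numbers and vectors *)

Definition sqn {R : realType} (z : R[i]) : R := complex.Re z ^+ 2 + complex.Im z ^+ 2.

Definition vsq {R : realType} {n : nat} (v : 'cV[R[i]]_n) : R :=
  \sum_(i < n) sqn (v i ord0).

Section Sqn.
Context {R : realType}.
Implicit Types z w : R[i].

Lemma sqn_ge0 z : 0 <= sqn z.
Proof. by rewrite addr_ge0 ?sqr_ge0. Qed.

Lemma normc_sqr z : Normc.normc z ^+ 2 = sqn z.
Proof. by case: z => a b; rewrite /= sqr_sqrtr // addr_ge0 ?sqr_ge0. Qed.

Lemma sqnE z : (sqn z)%:C = z^*%C * z.
Proof.
case: z => a b; apply/eqP; rewrite eq_complex /sqn /=.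
by apply/andP; split; apply/eqP; ring.
Qed.

Lemma sqnM z w : sqn (z * w) = sqn z * sqn w.
Proof. by case: z => a b; case: w => c d; rewrite /sqn /=; ring. Qed.

Lemma sqn0 : sqn (0 : R[i]) = 0.
Proof. by rewrite /sqn /= expr0n addr0. Qed.

Lemma sqn1 : sqn (1 : R[i]) = 1.
Proof. by rewrite /sqn /= expr1n expr0n addr0. Qed.

Lemma sqnR (r : R) : sqn r%:C = r ^+ 2.
Proof. by rewrite /sqn /= expr0n addr0. Qed.

Lemma vsq_ge0 n (v : 'cV[R[i]]_n) : 0 <= vsq v.
Proof. by apply: sumr_ge0 => i _; exact: sqn_ge0. Qed.

Lemma l2norm_sqr n (v : 'cV[R[i]]_n) : l2norm v = Num.sqrt (vsq v).
Proof. by congr Num.sqrt; apply: eq_bigr => i _; rewrite normc_sqr. Qed.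

Lemma vsqZ n (c : R[i]) (v : 'cV[R[i]]_n) : vsq (c *: v) = sqn c * vsq v.
Proof. by rewrite /vsq mulr_sumr; apply: eq_bigr => i _; rewrite mxE sqnM. Qed.

Lemma vsq0 n : vsq (0 : 'cV[R[i]]_n) = 0.
Proof. by rewrite /vsq big1 // => i _; rewrite mxE sqn0. Qed.

Lemma vsq_col m n (u : 'cV[R[i]]_m) (v : 'cV[R[i]]_n) :
  vsq (col_mx u v) = vsq u + vsq v.
Proof.
rewrite /vsq big_split_ord /=; congr (_ + _); apply: eq_bigr => i _.
  by rewrite col_mxEu.
by rewrite col_mxEd.
Qed.

Lemma vsq11 (v : 'cV[R[i]]_1) : vsq v = sqn (v ord0 ord0).
Proof. by rewrite /vsq big_ord1. Qed.

Lemma vsqE n (v : 'cV[R[i]]_n) : (vsq v)%:C = \sum_i (v i ord0)^*%C * v i ord0.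
Proof. by rewrite rmorph_sum; apply: eq_bigr => i _; exact: sqnE. Qed.

End Sqn.

(** * Contractions *)

Section Contraction.
Context {R : realType}.

(** The bound is on squares, so it is the square of the operator norm that is at
    most [t]. *)
Definition bounded_by (t : R) {p q} (M : 'M[R[i]]_(p, q)) :=
  forall v, vsq (M *m v) <= t * vsq v.

Definition strict_contraction {p q} (M : 'M[R[i]]_(p, q)) :=
  exists t, [/\ 0 <= t, t < 1 & bounded_by t M].

Lemma opnorm_le {t : R} {p q} (M : 'M[R[i]]_(p, q)) : 0 <= t ->
  bounded_by t M -> opnorm M <= Num.sqrt t.
Proof.
move=> t0 tM; apply: ge_sup.
  by exists (l2norm (M *m 0)); exists 0 => //=; rewrite l2norm_sqr vsq0 sqrtr0.
move=> _ [v /= v1 <-]; move: v1; rewrite !l2norm_sqr => v1.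
have v1' : vsq v <= 1.
  by rewrite -(sqr_sqrtr (vsq_ge0 v)) expr_le1 // sqrtr_ge0.
apply: ler_wsqrtr; apply: (le_trans (tM v)).
by rewrite ler_piMr.
Qed.

Lemma opnorm_lt1 {p q} (M : 'M[R[i]]_(p, q)) : strict_contraction M -> opnorm M < 1.
Proof.
case=> t [t0 t1 tM]; apply: (le_lt_trans (opnorm_le t0 tM)).
by rewrite -(sqrtr1 R) ltr_sqrt.
Qed.

Lemma bounded_by_mul {s t : R} {p q r} (M : 'M[R[i]]_(p, q)) (N : 'M[R[i]]_(q, r)) :
  0 <= s -> bounded_by s M -> bounded_by t N -> bounded_by (s * t) (M *m N).
Proof.
move=> s0 sM tN v; rewrite -mulmxA; apply: (le_trans (sM _)).
by rewrite -mulrA ler_wpM2l.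
Qed.

Lemma bounded_by_dsum {t : R} {p q r s} (M : 'M[R[i]]_(p, q)) (N : 'M[R[i]]_(r, s)) :
  bounded_by t M -> bounded_by t N -> bounded_by t (block_mx M 0 0 N).
Proof.
move=> tM tN v; rewrite -(vsubmxK v) mul_block_col !mul0mx addr0 add0r !vsq_col.
by rewrite mulrDr lerD.
Qed.

Lemma bounded_by_le {s t : R} {p q} (M : 'M[R[i]]_(p, q)) :
  s <= t -> bounded_by s M -> bounded_by t M.
Proof.
by move=> st sM v; apply: (le_trans (sM v)); rewrite ler_wpM2r ?vsq_ge0.
Qed.

Lemma bounded_byZ {t : R} {p q} (c : R[i]) (M : 'M[R[i]]_(p, q)) :
  bounded_by t M -> bounded_by (sqn c * t) (c *: M).
Proof.
by move=> tM v; rewrite -scalemxAl vsqZ -mulrA ler_wpM2l ?sqn_ge0.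
Qed.

Lemma bounded_by1 n : bounded_by 1 (1%:M : 'M[R[i]]_n).
Proof. by move=> v; rewrite mul1mx mul1r. Qed.

Lemma strict_contraction_mul {p q r} (M : 'M[R[i]]_(p, q)) (N : 'M[R[i]]_(q, r)) :
  strict_contraction M -> strict_contraction N -> strict_contraction (M *m N).
Proof.
case=> s [s0 s1 sM] [t [t0 t1 tN]]; exists (s * t); split.
- exact: mulr_ge0.
- exact: mulr_ilt1.
- exact: bounded_by_mul.
Qed.

Lemma strict_contraction_dsum {p q r s} (M : 'M[R[i]]_(p, q)) (N : 'M[R[i]]_(r, s)) :
  strict_contraction M -> strict_contraction N ->
  strict_contraction (block_mx M 0 0 N).
Proof.
case=> a [a0 a1 aM] [b [b0 b1 bN]]; exists (Num.max a b); split.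
- by rewrite le_max a0.
- by rewrite gt_max a1.
- by apply: bounded_by_dsum; [apply: bounded_by_le aM|apply: bounded_by_le bN];
    rewrite le_max lexx ?orbT.
Qed.

Lemma strict_contractionZ {t : R} {p q} (M : 'M[R[i]]_(p, q)) : 0 <= t -> t < 1 ->
  bounded_by 1 M -> strict_contraction (t%:C *: M).
Proof.
move=> t0 t1 cM; exists (t ^+ 2); split; first exact: sqr_ge0.
  by rewrite expr_lt1.
by rewrite -[t ^+ 2]mulr1 -sqnR; exact: bounded_byZ.
Qed.

End Contraction.

(** * Pointwise evaluation of matrices of functions *)

Definition evmx {R : realType} {X : topologicalType} {p q} (x : X)
  (F : 'M[X -> R[i]]_(p, q)) : 'M[R[i]]_(p, q) := map_mx (fun f => f x) F.

Section Evaluation.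
Context {R : realType} {X : topologicalType}.
Local Notation C := R[i].
Local Notation "'MX_ ( p , q )" := 'M[X -> C]_(p, q).

Lemma evmx_inj p q (F G : 'MX_(p, q)) : (forall x, evmx x F = evmx x G) -> F = G.
Proof.
move=> FG; apply/matrixP => i j; apply/funext => x.
by have /matrixP/(_ i j) := FG x; rewrite !mxE.
Qed.

Lemma evmx_mul p q r (F : 'MX_(p, q)) (G : 'MX_(q, r)) x :
  evmx x (F *m G) = evmx x F *m evmx x G.
Proof.
apply/matrixP => i j; rewrite !mxE fct_sumE; apply: eq_bigr => k _.
by rewrite !mxE.
Qed.

Lemma evmx_cst p q (M : 'M[C]_(p, q)) x : evmx x (scalar_cst X M) = M.
Proof. by apply/matrixP => i j; rewrite !mxE. Qed.

Lemma evmx0 p q x : evmx x (0 : 'MX_(p, q)) = 0.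
Proof. by apply/matrixP => i j; rewrite !mxE. Qed.

Lemma evmx_block p q r s (F : 'MX_(p, q)) (G : 'MX_(p, r)) (H : 'MX_(s, q))
  (K : 'MX_(s, r)) x :
  evmx x (block_mx F G H K) =
  block_mx (evmx x F) (evmx x G) (evmx x H) (evmx x K).
Proof. exact: map_block_mx. Qed.

Definition scalemxf {p q} (c : C) (F : 'MX_(p, q)) : 'MX_(p, q) :=
  scalar_cst X c%:M *m F.

Lemma evmxZ p q c (F : 'MX_(p, q)) x : evmx x (scalemxf c F) = c *: evmx x F.
Proof. by rewrite evmx_mul evmx_cst mul_scalar_mx. Qed.

Lemma scalemxfA p q a b (F : 'MX_(p, q)) :
  scalemxf a (scalemxf b F) = scalemxf (a * b) F.
Proof.
rewrite /scalemxf mulmxA; congr (_ *m _); apply: evmx_inj => x.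
by rewrite evmx_mul !evmx_cst -scalar_mxM.
Qed.

Lemma scale1mxf p q (F : 'MX_(p, q)) : scalemxf 1 F = F.
Proof. by apply: evmx_inj => x; rewrite evmxZ scale1r. Qed.

Lemma mxnorm_lt1 p q (F : 'MX_(p, q)) (t : R) : 0 <= t -> t < 1 ->
  (forall x, bounded_by t (evmx x F)) -> mxnorm F < 1.
Proof.
move=> t0 t1 tF; rewrite /mxnorm.
have [->|/set0P ne] := eqVneq (range (fun x : X => opnorm (evmx x F))) set0.
  by rewrite sup0.
apply: (@le_lt_trans _ _ (Num.sqrt t)); last by rewrite -(sqrtr1 R) ltr_sqrt.
apply: ge_sup => // _ [y _ <-]; exact: opnorm_le t0 (tF y).
Qed.

End Evaluation.

Lemma conjcM {R : realType} (z w : R[i]) : (z * w)^*%C = z^*%C * w^*%C.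
Proof. exact: rmorphM. Qed.

Lemma conjcD {R : realType} (z w : R[i]) : (z + w)^*%C = z^*%C + w^*%C.
Proof. exact: rmorphD. Qed.

Lemma conjcN {R : realType} (z : R[i]) : (- z)^*%C = - z^*%C.
Proof. exact: rmorphN. Qed.

Lemma conjcR {R : realType} (r : R) : (r%:C)^*%C = r%:C.
Proof. exact: conjc_real. Qed.

(** * Products of scalar contractions and direct sums of short columns and rows *)

Definition col2 {T : Type} (a b : T) : 'M[T]_(2, 1) :=
  \matrix_(i, j) if i == ord0 then a else b.
Definition row2 {T : Type} (a b : T) : 'M[T]_(1, 2) :=
  \matrix_(i, j) if j == ord0 then a else b.

Section Good.
Context {R : realType} {X : topologicalType}.
Variable A : set (X -> R[i]).
Local Notation C := R[i].

Inductive good : forall p q, 'M[X -> C]_(p, q) -> Prop :=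
| good_cst p q (M : 'M[C]_(p, q)) : bounded_by 1 M -> good (scalar_cst X M)
| good_col f g : A f -> A g -> (forall x, sqn (f x) + sqn (g x) <= 1) ->
    good (col2 f g)
| good_row f g : A f -> A g -> (forall x, sqn (f x) + sqn (g x) <= 1) ->
    good (row2 f g)
| good_mul p q r (F : 'M[X -> C]_(p, q)) (G : 'M[X -> C]_(q, r)) :
    good F -> good G -> good (F *m G)
| good_dsum p q r s (F : 'M[X -> C]_(p, q)) (G : 'M[X -> C]_(r, s)) :
    good F -> good G -> good (block_mx F 0 0 G).

(** Built from the left, whereas [alt_prod] grows on the right: prepending a factor
    keeps the row index of the remaining product a variable, so that sizes match
    without transport. *)
Inductive factorized : nat -> forall p q, 'M[X -> C]_(p, q) -> Prop :=
| factorized_cst p q (M : 'M[C]_(p, q)) : strict_contraction M -> factorized 0 (scalar_cst X M)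
| factorized_step m p q r s (M : 'M[C]_(p, q)) (D : 'M[X -> C]_(q, r))
    (F : 'M[X -> C]_(r, s)) : strict_contraction M -> block_diag A D ->
    factorized m F -> factorized m.+1 (scalar_cst X M *m D *m F).

Hypothesis uA : unital_subalgebra A.

Lemma alg_comb c f g : A f -> A g -> A (fun x => c * f x + g x).
Proof. by case: uA => _ _ + _; exact. Qed.

Lemma alg_mul f g : A f -> A g -> A (fun x => f x * g x).
Proof. by case: uA => _ _ _; exact. Qed.

Lemma alg_cst c : A (fun=> c).
Proof.
have A1 : A (fun=> 1) by case: uA.
have := alg_comb (c - 1) A1 A1; congr A; apply/funext => x; ring.
Qed.

Lemma alg_scale c f : A f -> A (fun x => c * f x).
Proof. exact/alg_mul/alg_cst. Qed.

Lemma alg_add f g : A f -> A g -> A (fun x => f x + g x).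
Proof.
by move=> Af Ag; have := alg_comb 1 Af Ag; congr A; apply/funext => x; ring.
Qed.

Lemma alg_sum (I : Type) (r : seq I) (f : I -> X -> C) :
  (forall i, A (f i)) -> A (fun x => \sum_(i <- r) f i x).
Proof.
move=> Af; elim: r => [|i r IH].
  by have := alg_cst 0; congr A; apply/funext => x; rewrite big_nil.
by have := alg_add (Af i) IH; congr A; apply/funext => x; rewrite big_cons.
Qed.

Lemma scalar_cst_mul p q r (M : 'M[C]_(p, q)) (N : 'M[C]_(q, r)) :
  scalar_cst X (M *m N) = scalar_cst X M *m scalar_cst X N.
Proof. by apply: evmx_inj => x; rewrite evmx_mul !evmx_cst. Qed.

Lemma scalar_cst_dsum p q r s (M : 'M[C]_(p, q)) (N : 'M[C]_(r, s)) :
  scalar_cst X (block_mx M 0 0 N) =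
  block_mx (scalar_cst X M) 0 0 (scalar_cst X N).
Proof.
by apply: evmx_inj => x; rewrite evmx_block !evmx_cst !evmx0.
Qed.

Lemma dsum_mul (T : pzSemiRingType) p q r p' q' r' (F : 'M[T]_(p, q))
  (G : 'M[T]_(q, r)) (F' : 'M[T]_(p', q')) (G' : 'M[T]_(q', r')) :
  block_mx (F *m G) 0 0 (F' *m G') = block_mx F 0 0 F' *m block_mx G 0 0 G'.
Proof. by rewrite mulmx_block !mul0mx !mulmx0 !addr0 !add0r. Qed.

Lemma scalemxf_cst p q c (M : 'M[C]_(p, q)) :
  scalemxf c (scalar_cst X M) = scalar_cst X (c *: M).
Proof. by rewrite /scalemxf -scalar_cst_mul mul_scalar_mx. Qed.

Lemma bounded_by_row10 (p q : nat) :
  bounded_by (1 : R) (row_mx 1%:M 0 : 'M[C]_(p, p + q)).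
Proof.
move=> v; rewrite -(vsubmxK v) mul_row_col mul1mx mul0mx addr0 mul1r vsq_col.
by rewrite lerDl vsq_ge0.
Qed.

Lemma bounded_by_col10 (p q : nat) :
  bounded_by (1 : R) (col_mx 1%:M 0 : 'M[C]_(p + q, p)).
Proof. by move=> v; rewrite mul_col_mx mul1mx mul0mx mul1r vsq_col vsq0 addr0. Qed.

Lemma col2_mul (a b : C) (v : 'cV[C]_1) :
  vsq (col2 a b *m v) = (sqn a + sqn b) * vsq v.
Proof.
rewrite vsq11 /vsq big_ord_recl big_ord1 !mxE !big_ord1 !mxE /= !sqnM.
by rewrite -mulrDl.
Qed.

Lemma sqn_cauchy2 (a b c d : C) :
  sqn (a * c + b * d) <= (sqn a + sqn b) * (sqn c + sqn d).
Proof.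
rewrite -subr_ge0.
have -> : (sqn a + sqn b) * (sqn c + sqn d) - sqn (a * c + b * d)
  = sqn (a * d^*%C - b * c^*%C).
  case: a b c d => [a a'] [b b'] [c c'] [d d']; rewrite /sqn /=; ring.
exact: sqn_ge0.
Qed.

Lemma row2_mul (a b : C) (v : 'cV[C]_2) :
  vsq (row2 a b *m v) <= (sqn a + sqn b) * vsq v.
Proof.
rewrite vsq11 /vsq !mxE !big_ord_recl !big_ord0 !addr0 !mxE /=.
exact: sqn_cauchy2.
Qed.

Lemma evmx_col2 (f g : X -> C) x : evmx x (col2 f g) = col2 (f x) (g x).
Proof. by apply/matrixP => i j; rewrite !mxE; case: ifP. Qed.

Lemma evmx_row2 (f g : X -> C) x : evmx x (row2 f g) = row2 (f x) (g x).
Proof. by apply/matrixP => i j; rewrite !mxE; case: ifP. Qed.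

Lemma sqn_scale_le (t : R) (f g : X -> C) x : 0 <= t ->
  sqn (f x) + sqn (g x) <= 1 -> sqn (t%:C * f x) + sqn (t%:C * g x) <= t ^+ 2.
Proof. by move=> t0 fg; rewrite !sqnM sqnR -mulrDr ler_piMr ?sqr_ge0. Qed.

Lemma block_diag_col2 (t : R) f g : 0 <= t -> t < 1 -> A f -> A g ->
  (forall x, sqn (f x) + sqn (g x) <= 1) ->
  block_diag A (col2 (fun x => t%:C * f x) (fun x => t%:C * g x)).
Proof.
move=> t0 t1 Af Ag fg; apply: block_diag_col; split.
  by move=> i j; rewrite mxE; case: ifP => _; exact: alg_scale.
apply: (@mxnorm_lt1 _ _ _ _ _ (t ^+ 2)); rewrite ?sqr_ge0 ?expr_lt1 // => x v.
by rewrite evmx_col2 col2_mul ler_wpM2r ?vsq_ge0 ?sqn_scale_le.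
Qed.

Lemma block_diag_row2 (t : R) f g : 0 <= t -> t < 1 -> A f -> A g ->
  (forall x, sqn (f x) + sqn (g x) <= 1) ->
  block_diag A (row2 (fun x => t%:C * f x) (fun x => t%:C * g x)).
Proof.
move=> t0 t1 Af Ag fg; apply: block_diag_row; split.
  by move=> i j; rewrite mxE; case: ifP => _; exact: alg_scale.
apply: (@mxnorm_lt1 _ _ _ _ _ (t ^+ 2)); rewrite ?sqr_ge0 ?expr_lt1 // => x v.
rewrite evmx_row2; apply: (le_trans (row2_mul _ _ _)).
by rewrite ler_wpM2r ?vsq_ge0 ?sqn_scale_le.
Qed.

(** A multiple of the identity, compressed from a direct sum of columns: this
    is what makes it possible to lengthen a factorization. *)
Lemma block_diag_identity (t : R) n : 0 <= t -> t < 1 ->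
  exists p (D : 'M[X -> C]_(p, n.+1)) (E : 'M[C]_(n.+1, p)),
    [/\ block_diag A D, bounded_by 1 E &
        scalar_cst X E *m D = scalar_cst X (t%:C%:M)].
Proof.
move=> t0 t1.
pose D1 := col2 (fun=> t%:C * 1) (fun=> t%:C * 0) : 'M[X -> C]_(2, 1).
have D1P : block_diag A D1.
  apply: (@block_diag_col2 t (fun=> 1) (fun=> 0)) => // [||x].
  - exact: alg_cst.
  - exact: alg_cst.
  - by rewrite sqn1 sqn0 addr0.
pose E1 := row2 1 0 : 'M[C]_(1, 2).
have E1P : bounded_by 1 E1.
  by move=> v; apply: (le_trans (row2_mul _ _ _)); rewrite sqn1 sqn0 addr0.
have E1D1 : scalar_cst X E1 *m D1 = scalar_cst X t%:C%:M.
  apply: evmx_inj => x; rewrite evmx_mul !evmx_cst evmx_col2.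
  apply/matrixP => i j; rewrite !ord1 !mxE big_ord_recl big_ord1 !mxE /=.
  by rewrite mulr1 mul1r mul0r addr0 mulr1n.
elim: n => [|n [p [D [E [DP EP ED]]]]]; first by exists 2, D1, E1.
exists (2 + p)%N, (block_mx D1 0 0 D : 'M[X -> C]_(2 + p, 1 + n.+1)),
  (block_mx E1 0 0 E : 'M[C]_(1 + n.+1, 2 + p)); split.
- exact: (block_diag_sum D1P DP).
- exact: (bounded_by_dsum E1P EP).
- have : scalar_cst X (block_mx E1 0 0 E) *m block_mx D1 0 0 D
      = scalar_cst X (t%:C%:M : 'M[C]_(1 + n.+1)).
    by rewrite scalar_cst_dsum -dsum_mul E1D1 ED -scalar_cst_dsum -scalar_mx_block.
  exact.
Qed.

(** Direct sums need factorizations of equal length.  The last scalar matrix has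
    norm strictly below one, which leaves room for one more factor, a multiple of
    the identity.  One column is added first because a direct sum cannot be
    empty. *)
Lemma factorized_pad m p q (F : 'M[X -> C]_(p, q)) : factorized m F -> factorized m.+1 F.
Proof.
elim=> {m p q F} [p q M [s [s0 s1 sM]]|m p q r s M D F cM dD _ IH]; last first.
  exact: factorized_step.
(* [t ^ 4] is halfway between [s] and 1: two factors [t] are spent on the new
   identity block and its compression, and [s / t ^ 4] bounds what remains. *)
pose s' := (s + 1) / 2; pose t := Num.sqrt (Num.sqrt s').
have s'0 : 0 < s' by rewrite /s'; lra.
have t0 : 0 < t by rewrite !sqrtr_gt0.
have t4 : t ^+ 4 = s'.
  by rewrite (exprM t 2 2) !sqr_sqrtr ?sqrtr_ge0 ?ltW.
have t1 : t < 1.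
  by rewrite -(@expr_lt1 _ 4) ?ltW // t4 /s'; lra.
have [l [D [E [DP EP ED]]]] := @block_diag_identity t q (ltW t0) t1.
rewrite -addn1 in D E DP EP ED.
pose M1 := (t ^- 2)%:C *: (M *m (row_mx 1%:M 0 *m E)).
pose M2 : 'M[C]_(q + 1, q) := t%:C *: col_mx 1%:M 0.
have -> : scalar_cst X M = scalar_cst X M1 *m D *m scalar_cst X M2.
  apply: evmx_inj => x; rewrite !evmx_mul !evmx_cst.
  have /(congr1 (evmx x)) := ED; rewrite evmx_mul !evmx_cst => EDx.
  have JK : row_mx 1%:M (0 : 'M[C]_(q, 1)) *m col_mx 1%:M 0 = 1%:M :> 'M[C]_q.
    by rewrite mul_row_col mulmx1 mul0mx addr0.
  rewrite -!scalemxAl -scalemxAr !scalerA -!mulmxA (mulmxA E) EDx.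
  rewrite mul_scalar_mx -!scalemxAr JK mulmx1 scalerA -!rmorphM /=.
  have -> : t ^- 2 * t * t = 1 by field; rewrite gt_eqF.
  by rewrite scale1r.
apply: factorized_step => //; last
  by apply/factorized_cst/strict_contractionZ/bounded_by_col10 => //; exact: ltW.
exists ((t ^- 2) ^+ 2 * (s * (1 * 1))); split.
- by rewrite mulr_ge0 ?sqr_ge0 ?mulr_ge0.
- have -> : (t ^- 2) ^+ 2 * (s * (1 * 1)) = s / t ^+ 4.
    by field; rewrite gt_eqF.
  rewrite ltr_pdivrMr; last by rewrite exprn_gt0.
  by rewrite mul1r t4 /s'; lra.
- rewrite -sqnR; apply/bounded_byZ/bounded_by_mul => //.
  exact/bounded_by_mul/EP/bounded_by_row10.
Qed.

Lemma factorized_padn k m p q (F : 'M[X -> C]_(p, q)) : factorized m F -> factorized (k + m) F.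
Proof. by move=> mF; elim: k => //= k; rewrite addSn; exact: factorized_pad. Qed.

Lemma factorized_scalar m p q r (M : 'M[C]_(p, q)) (F : 'M[X -> C]_(q, r)) :
  strict_contraction M -> factorized m F -> factorized m (scalar_cst X M *m F).
Proof.
move=> cM mF; case: mF M cM => {m q r F} [q r N cN|m q r s t N D F cN dD mF] M cM.
  by rewrite -scalar_cst_mul; apply/factorized_cst/strict_contraction_mul.
rewrite !mulmxA -scalar_cst_mul; apply: factorized_step => //.
exact: strict_contraction_mul.
Qed.

Lemma factorized_mul m m' p q r (F : 'M[X -> C]_(p, q)) (G : 'M[X -> C]_(q, r)) :
  factorized m F -> factorized m' G -> factorized (m + m') (F *m G).
Proof.
move=> mF m'G; elim: mF G m'G => {m p q F} [p q M cM|m p q s t M D F cM dD _ IH] G mG.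
  exact: factorized_scalar.
by rewrite -mulmxA addSn; apply: factorized_step => //; exact: IH.
Qed.

Lemma factorized_inv m p s (F : 'M[X -> C]_(p, s)) : factorized m F ->
  match m with
  | 0 => exists2 M, strict_contraction M & F = scalar_cst X M
  | m'.+1 => exists q r (M : 'M[C]_(p, q)) (D : 'M[X -> C]_(q, r)) (G : 'M[X -> C]_(r, s)),
     [/\ strict_contraction M, block_diag A D, factorized m' G &
      F = scalar_cst X M *m D *m G]
  end.
Proof. by case=> {m p s F} [p q M|m p q r s M D F] *; [exists M|exists q, r, M, D, F]. Qed.

Lemma factorized_dsum m p q r s (F : 'M[X -> C]_(p, q)) (G : 'M[X -> C]_(r, s)) :
  factorized m F -> factorized m G -> factorized m (block_mx F 0 0 G).
Proof.
move=> mF.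
elim: mF r s G => {m p q F} [p q M cM|m p q r s M D F cM dD _ IH] r' s' G.
  move=> /factorized_inv.
  case=> N cN ->; rewrite -scalar_cst_dsum.
  exact/factorized_cst/strict_contraction_dsum.
move=> /factorized_inv [q2 [r2 [N [D2 [G2 [cN dD2 mG2 ->]]]]]].
rewrite dsum_mul dsum_mul -scalar_cst_dsum; apply: factorized_step.
- exact: strict_contraction_dsum.
- exact: block_diag_sum.
- exact: IH.
Qed.

Lemma strict_contraction_scalar (t : R) n : 0 <= t -> t < 1 ->
  strict_contraction (t%:C%:M : 'M[C]_n).
Proof.
by move=> t0 t1; rewrite -scalemx1; exact: strict_contractionZ (@bounded_by1 R n).
Qed.

(** Splitting a scalar strictly below one as a product leaves room between all
    the factors of a good matrix. *)
Lemma good_factorized p q (F : 'M[X -> C]_(p, q)) : good F ->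
  forall t : R, 0 <= t -> t < 1 -> exists m, factorized m (scalemxf t%:C F).
Proof.
have block_fac p' q' (D : 'M[X -> C]_(p', q')) :
  (forall t : R, 0 <= t -> t < 1 -> block_diag A (scalemxf t%:C D)) ->
  forall t : R, 0 <= t -> t < 1 -> factorized 1 (scalemxf t%:C D).
  move=> dD t t0 t1; pose s := Num.sqrt t; pose u := Num.sqrt s.
  have s1 : s < 1 by rewrite -(sqrtr1 R) ltr_sqrt.
  have u1 : u < 1 by rewrite -(sqrtr1 R) ltr_sqrt.
  have -> : scalemxf t%:C D =
    scalar_cst X u%:C%:M *m scalemxf u%:C D *m scalar_cst X s%:C%:M.
    apply: evmx_inj => x; rewrite !(evmxZ, evmx_mul, evmx_cst).
    rewrite mul_scalar_mx mul_mx_scalar !scalerA -!rmorphM /=.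
    have uu : u * u = s by rewrite -expr2 sqr_sqrtr ?sqrtr_ge0.
    have ss : s * s = t by rewrite -expr2 sqr_sqrtr.
    by congr (_%:C *: _); rewrite uu ss.
  apply: factorized_step;
    last exact/factorized_cst/(strict_contraction_scalar _ (sqrtr_ge0 t)).
    exact: (strict_contraction_scalar _ (sqrtr_ge0 s)).
  by apply: dD; rewrite ?sqrtr_ge0.
elim=> {p q F} [p q M cM|f g Af Ag fg|f g Af Ag fg|p q r F G _ IF _ IG|
    p q r s F G _ IF _ IG] t t0 t1.
- exists 0%N; rewrite scalemxf_cst; exact/factorized_cst/strict_contractionZ.
- exists 1%N; apply: block_fac t0 t1 => {t}t t0 t1.
  have := block_diag_col2 t0 t1 Af Ag fg; congr (block_diag A _).
  apply: evmx_inj => x; rewrite evmxZ !evmx_col2.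
  by apply/matrixP => i j; rewrite !mxE; case: ifP.
- exists 1%N; apply: block_fac t0 t1 => {t}t t0 t1.
  have := block_diag_row2 t0 t1 Af Ag fg; congr (block_diag A _).
  apply: evmx_inj => x; rewrite evmxZ !evmx_row2.
  by apply/matrixP => i j; rewrite !mxE; case: ifP.
- have s1 : Num.sqrt t < 1 by rewrite -(sqrtr1 R) ltr_sqrt.
  have [m mF] := IF _ (sqrtr_ge0 t) s1; have [m' mG] := IG _ (sqrtr_ge0 t) s1.
  exists (m + m')%N; have := factorized_mul mF mG; congr (factorized _ _).
  apply: evmx_inj => x; rewrite !(evmxZ, evmx_mul) -scalemxAl -scalemxAr.
  by rewrite scalerA -rmorphM /= -expr2 sqr_sqrtr.
- have [m mF] := IF _ t0 t1; have [m' mG] := IG _ t0 t1.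
  exists (m + m')%N; have mG' := factorized_padn m mG.
  have := factorized_dsum (factorized_padn m' mF); rewrite [(m' + m)%N]addnC => /(_ _ _ _ mG').
  congr (factorized _ _); apply: evmx_inj => x.
  by rewrite evmxZ !evmx_block !evmxZ !evmx0 scale_block_mx !scaler0.
Qed.

(** The recursion of [alt_prod] on its last factor, restated on the first. *)
Lemma alt_prod_cons (r c : nat -> nat) (M : forall k, 'M[C]_(r k, c k))
  (D : forall k, 'M[X -> C]_(c k, r k.+1)) m :
  alt_prod M D m.+1 = scalar_cst X (M 0%N) *m D 0%N *m
    @alt_prod R X (fun k => r k.+1) (fun k => c k.+1) (fun k => M k.+1)
      (fun k => D k.+1) m.
Proof. by elim: m => [//|m IH]; rewrite [LHS]/= -/(alt_prod M D m.+1) IH !mulmxA. Qed.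

Lemma factorized_alt_prod m p q (F : 'M[X -> C]_(p, q)) : factorized m F ->
  exists (r c : nat -> nat) (M : forall k, 'M[C]_(r k, c k))
    (D : forall k, 'M[X -> C]_(c k, r k.+1)) (szF : (r 0%N = p) * (c m = q)),
    [/\ forall k, (k <= m)%N -> opnorm (M k) < 1,
        forall k, (k < m)%N -> block_diag A (D k)
      & F = castmx szF (alt_prod M D m)].
Proof.
elim=> {m p q F} [p q M cM|m p q r s M D F cM dD _].
  exists (fun=> p), (fun=> q), (fun=> M), (fun=> 0), (erefl, erefl).
  by split=> // k _; exact: opnorm_lt1.
move=> [r' [c' [M' [D' [[e1 e2] [cM' dD' eF]]]]]].
destruct e1, e2; rewrite {}eF castmx_id {F}.
pose r1 k := if k is k'.+1 then r' k' else p.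
pose c1 k := if k is k'.+1 then c' k' else q.
pose M1 k : 'M[C]_(r1 k, c1 k) :=
  match k with 0 => M | k'.+1 => M' k' end.
pose D1 k : 'M[X -> C]_(c1 k, r1 k.+1) :=
  match k with 0 => D | k'.+1 => D' k' end.
exists r1, c1, M1, D1, (erefl, erefl); split.
- by case=> [_|k]; [exact: opnorm_lt1|exact: cM'].
- by case=> [_|k]; [exact: dD|exact: dD'].
- by rewrite castmx_id (alt_prod_cons M1 D1).
Qed.

End Good.

(** * Vectors with the same Gram matrix differ by a contraction *)

Section Adjoint.
Context {R : realType}.
Local Notation C := R[i].

Definition adj {p q} (M : 'M[C]_(p, q)) : 'M[C]_(q, p) := map_mx conjc M^T.

Lemma adjE p q (M : 'M[C]_(p, q)) i j : adj M i j = (M j i)^*%C.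
Proof. by rewrite !mxE. Qed.

Lemma adj_mulE p q r (M : 'M[C]_(q, p)) (N : 'M[C]_(q, r)) j k :
  (adj M *m N) j k = \sum_i (M i j)^*%C * N i k.
Proof. by rewrite mxE; apply: eq_bigr => i _; rewrite adjE. Qed.

Lemma adj_mul p q r (M : 'M[C]_(p, q)) (N : 'M[C]_(q, r)) :
  adj (M *m N) = adj N *m adj M.
Proof. by rewrite /adj trmx_mul map_mxM. Qed.

Lemma adjK p q (M : 'M[C]_(p, q)) : adj (adj M) = M.
Proof. by apply/matrixP => i j; rewrite !adjE conjcK. Qed.

Lemma adjB p q (M N : 'M[C]_(p, q)) : adj (M - N) = adj M - adj N.
Proof. by apply/matrixP => i j; rewrite !mxE rmorphB. Qed.

Lemma vsq_adj n (v : 'cV[C]_n) : adj v *m v = ((vsq v)%:C)%:M.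
Proof.
apply/matrixP => i j; rewrite !ord1 !mxE vsqE mulr1n.
by apply: eq_bigr => k _; rewrite adjE.
Qed.

Lemma vsq_eq0 n (v : 'cV[C]_n) : vsq v = 0 -> v = 0.
Proof.
move=> /eqP; rewrite /vsq psumr_eq0 => [/allP v0|i _]; last exact: sqn_ge0.
apply/matrixP => i j; rewrite ord1 mxE.
have := v0 i (mem_index_enum i); rewrite -normc_sqr sqrf_eq0 => /eqP.
exact: Normc.eq0_normc.
Qed.

Lemma adj_mul_eq0 n (v : 'cV[C]_n) : adj v *m v = 0 -> v = 0.
Proof.
rewrite vsq_adj => /matrixP/(_ ord0 ord0); rewrite !mxE mulr1n.
by move=> /complexI /vsq_eq0.
Qed.

Lemma vsq_mul p q (M : 'M[C]_(p, q)) (v : 'cV[C]_q) :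
  ((vsq (M *m v))%:C)%:M = adj v *m (adj M *m M) *m v.
Proof. by rewrite -vsq_adj adj_mul !mulmxA. Qed.

Lemma gram_unit p q (B : 'M[C]_(p, q)) : row_free B^T -> adj B *m B \in unitmx.
Proof.
move=> fB; rewrite -row_free_unit; apply: inj_row_free => v.
rewrite mulmxA => vB0.
have vB : adj (adj (v *m adj B)) *m adj (v *m adj B) = 0.
  by rewrite adjK adj_mul adjK mulmxA vB0 mul0mx.
have := adj_mul_eq0 vB => /(congr1 adj); rewrite adjK => vB1.
have : row_free (adj B) by rewrite /adj row_free_map.
move=> /row_freeP[D BD]; rewrite -(mulmx1 v) -BD mulmxA vB1 /adj.
by rewrite trmx0 map_mx0 mul0mx.
Qed.

(** Finitely many values of maximal rank span all values; an independent
    subfamily of them is then extracted. *)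
Lemma finite_column_basis (Y : Type) q (H : Y -> 'cV[C]_q) :
  exists r (us : 'I_r -> Y), let B := \matrix_(i, j) H (us j) i ord0 in
    row_free B^T /\ forall y, exists a, H y = B *m a.
Proof.
pose S m (us : 'I_m -> Y) := \matrix_(j, i) H (us j) i ord0 : 'M[C]_(m, q).
pose P r := `[< exists m (us : 'I_m -> Y), \rank (S m us) = r >].
have P0 : exists r, P r.
  have us : 'I_0 -> Y by case.
  by exists (\rank (S 0%N us)); apply/asboolP; exists 0%N, us.
have Pq r : P r -> (r <= q)%N.
  by move=> /asboolP[m [us <-]]; exact: rank_leq_col.
case: (ex_maxnP P0 Pq) => r /asboolP[m [us Sr]] rmax.
have span y : ((H y)^T <= S m us)%MS.
  pose us' (j : 'I_m.+1) := oapp us y (unlift ord0 j).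
  have sub : (S m us <= S m.+1 us')%MS.
    apply/row_subP => j.
    have -> : row j (S m us) = row (lift ord0 j) (S m.+1 us').
      by apply/rowP => i; rewrite !mxE /us' liftK.
    exact: row_sub.
  have le : (\rank (S m.+1 us') <= \rank (S m us))%N.
    by rewrite Sr; apply: rmax; apply/asboolP; exists m.+1, us'.
  have /eqmxP eqS : (S m us == S m.+1 us')%MS.
    by rewrite -(mxrank_leqif_eq sub) eqn_leq mxrankS.
  rewrite eqS; have -> : (H y)^T = row ord0 (S m.+1 us').
    by apply/rowP => i; rewrite !mxE /us' unlift_none.
  exact: row_sub.
pose f := maxrankfun (S m us).
exists (\rank (S m us)), (us \o f) => B.
have BE : B^T = rowsub f (S m us).
  by apply/matrixP => i j; rewrite !mxE.
split; first by rewrite BE; exact: maxrowsub_free.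
move=> y; have : ((H y)^T <= B^T)%MS by rewrite BE eq_maxrowsub.
move=> /submxP[D HD]; exists D^T; apply: trmx_inj.
by rewrite trmx_mul trmxK.
Qed.

(** Equal Gram matrices make [H y |-> G y] a well defined isometry between the
    spans.  It is extended by zero on the orthogonal complement: with [B] a basis
    of the span of the [H y] and [B'] the corresponding values of [G], this is
    [B' (B^* B)^-1 B^*]. *)
Lemma lurking_isometry (Y : Type) p q (G : Y -> 'cV[C]_p) (H : Y -> 'cV[C]_q) :
  (forall u v, adj (G u) *m G v = adj (H u) *m H v) ->
  exists2 U : 'M[C]_(p, q), bounded_by 1 U & forall y, G y = U *m H y.
Proof.
move=> GH; have [r [us]] := finite_column_basis H.
set B := \matrix_(i, j) _ => -[fB span].
pose B' : 'M[C]_(p, r) := \matrix_(i, j) G (us j) i ord0.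
have gram y : adj B' *m G y = adj B *m H y.
  apply/matrixP => j k; rewrite !ord1.
  have := congr1 (fun M : 'M[C]_1 => M ord0 ord0) (GH (us j) y).
  rewrite !adj_mulE => E; transitivity (\sum_i (G (us j) i ord0)^*%C * G y i ord0).
    by apply: eq_bigr => i _; rewrite mxE.
  by rewrite E; apply: eq_bigr => i _; rewrite mxE.
have gram2 : adj B' *m B' = adj B *m B.
  apply/matrixP => j k; have := congr1 (fun M : 'cV[C]_r => M j ord0) (gram (us k)).
  rewrite !adj_mulE => E; transitivity (\sum_i (B' i j)^*%C * G (us k) i ord0).
    by apply: eq_bigr => i _; rewrite [B' i k]mxE.
  by rewrite E; apply: eq_bigr => i _; rewrite [B i k]mxE.
set W := adj B *m B; have Wu : W \in unitmx := gram_unit fB.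
have adjW : adj W = W by rewrite /W adj_mul adjK.
have adjWV : adj (invmx W) = invmx W.
  have E : adj (invmx W) *m W = 1%:M.
    by rewrite -{2}adjW -adj_mul mulmxV // /adj trmx1 map_mx1.
  by rewrite -[LHS](mulmxK Wu) E mul1mx.
exists (B' *m invmx W *m adj B).
  move=> v; rewrite mul1r.
  pose P := B *m invmx W *m adj B.
  have adjP : adj P = P by rewrite /P !adj_mul adjK adjWV mulmxA.
  have PP : P *m P = P.
    by rewrite /P !mulmxA -(mulmxA _ (adj B) B) -/W mulmxKV.
  have UU : adj (B' *m invmx W *m adj B) *m (B' *m invmx W *m adj B) = P.
    rewrite !adj_mul adjK adjWV !mulmxA -(mulmxA _ (adj B') B') gram2 -/W.
    by rewrite mulmxKV.
  clearbody P; rewrite -subr_ge0; have := vsq_ge0 (v - P *m v); congr (0 <= _).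
  apply: complexI; rewrite rmorphB.
  suff : ((vsq (v - P *m v))%:C)%:M = ((vsq v)%:C)%:M
     - ((vsq (B' *m invmx W *m adj B *m v))%:C)%:M :> 'M[C]_1.
    by move=> /matrixP/(_ ord0 ord0); rewrite !mxE !mulr1n.
  rewrite vsq_mul UU -!vsq_adj adjB mulmxBl !mulmxBr adj_mul adjP.
  rewrite !mulmxA -(mulmxA _ P P) PP.
  by rewrite [X in _ - X]subrr subr0.
move=> y; have [a Ha] := span y.
have UH : B' *m invmx W *m adj B *m H y = B' *m a.
  by rewrite Ha !mulmxA -(mulmxA _ (adj B) B) -/W mulmxKV.
rewrite UH; apply/eqP; rewrite -subr_eq0; apply/eqP/adj_mul_eq0.
have gramy : adj (G y) *m B' = adj (H y) *m B.
  by rewrite -[LHS]adjK adj_mul adjK gram adj_mul adjK.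
transitivity (adj (H y - B *m a) *m (H y - B *m a)); last first.
  by rewrite -Ha subrr mulmx0.
have aG : adj a *m adj B' *m G y = adj a *m adj B *m H y.
  by rewrite -!mulmxA gram.
have aB : adj a *m adj B' *m B' = adj a *m adj B *m B by rewrite -!mulmxA gram2.
rewrite !adjB !mulmxBl !mulmxBr !adj_mul !(mulmxA _ B') !(mulmxA _ B).
by rewrite gramy GH aG aB.
Qed.

End Adjoint.

(** * The order on kernels *)

Section Kernel.
Context {R : realType} {X : topologicalType} {n : nat}.
Variable A : set (X -> R[i]).
Local Notation C := R[i].
Local Notation Y := (X * 'I_n)%type.
Local Notation kernel := (Y -> Y -> C).

(** A point of [X * 'I_n] names a column of a matrix over [X] at a point, so that a
    kernel with values in matrices is a scalar function of two such indices. *)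
Definition colv {p} (F : 'M[X -> C]_(p, n)) (u : Y) : 'cV[C]_p := col u.2 (evmx u.1 F).

Definition gram {p} (F : 'M[X -> C]_(p, n)) : kernel :=
  fun u v => \sum_k (F k u.2 u.1)^*%C * F k v.2 v.1.

Definition rowA (z : Y -> C) := forall b, A (fun x => z (x, b)).

Definition sqk (z : Y -> C) : kernel := fun u v => (z u)^*%C * z v.

Definition rowmx (z : Y -> C) : 'M[X -> C]_(1, n) := \row_b (fun x => z (x, b)).

Definition unitk : kernel := fun u v => (u.2 == v.2)%:R.

(** The operator inequality [G^* G <= H^* H], witnessed by a factorization. *)
Definition lek (k k' : kernel) := exists p q (G : 'M[X -> C]_(p, n))
  (H : 'M[X -> C]_(q, n)) (g : 'M[X -> C]_(p, q)),
  [/\ good A g, forall i j, A (H i j), G = g *m H, gram G = k & gram H = k'].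

Definition scalek (r : R) (k : kernel) : kernel := fun u v => r%:C * k u v.

(** A difference of kernels counts as nonnegative when it is the gap of some
    inequality; the common part [k' - k] is not cancelled, which makes the notion
    additive by construction. *)
Definition posk (k : kernel) := exists k', lek (k' - k) k'.

Definition actr (a : X -> C) (z : Y -> C) : Y -> C := fun u => a u.1 * z u.

Lemma colvE p (F : 'M[X -> C]_(p, n)) u i j : colv F u i j = F i u.2 u.1.
Proof. by rewrite !mxE. Qed.

Lemma gram_colv p (F : 'M[X -> C]_(p, n)) u v :
  adj (colv F u) *m colv F v = (gram F u v)%:M.
Proof.
apply/matrixP => i j; rewrite !ord1 adj_mulE [RHS]mxE mulr1n.
by apply: eq_bigr => k _; rewrite !colvE.
Qed.

Lemma colv_mul p q (G : 'M[X -> C]_(p, q)) (F : 'M[X -> C]_(q, n)) u :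
  colv (G *m F) u = evmx u.1 G *m colv F u.
Proof. by rewrite /colv evmx_mul colE colE mulmxA. Qed.

Lemma colv_inj p (F G : 'M[X -> C]_(p, n)) : (forall u, colv F u = colv G u) -> F = G.
Proof.
move=> FG; apply/matrixP => i j; apply/funext => x.
by have /matrixP/(_ i ord0) := FG (x, j); rewrite !colvE.
Qed.

Lemma gram_eq p q (G : 'M[X -> C]_(p, n)) (H : 'M[X -> C]_(q, n)) :
  gram G = gram H ->
  exists2 U : 'M[C]_(p, q), bounded_by 1 U & G = scalar_cst X U *m H.
Proof.
move=> GH; have [|U U1 UH] := @lurking_isometry R Y p q (colv G) (colv H).
  by move=> u v; rewrite !gram_colv GH.
by exists U => //; apply: colv_inj => u; rewrite colv_mul evmx_cst.
Qed.

Lemma gram_col p q (G : 'M[X -> C]_(p, n)) (H : 'M[X -> C]_(q, n)) :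
  gram (col_mx G H) = gram G + gram H.
Proof.
apply/funext => u; apply/funext => v; rewrite /gram big_split_ord /=.
by congr (_ + _); apply: eq_bigr => i _; rewrite ?col_mxEu ?col_mxEd.
Qed.

Lemma gram_scale p (c : C) (G : 'M[X -> C]_(p, n)) :
  gram (scalemxf c G) = scalek (sqn c) (gram G).
Proof.
apply/funext => u; apply/funext => v; rewrite /scalek /gram mulr_sumr.
apply: eq_bigr => i _; have E w : scalemxf c G i w.2 w.1 = c * G i w.2 w.1.
  by have /matrixP/(_ i w.2) := evmxZ c G w.1; rewrite !mxE.
by rewrite !E rmorphM sqnE; ring.
Qed.

Lemma gram_row z : gram (rowmx z) = sqk z.
Proof.
by apply/funext => -[x a]; apply/funext => -[y b]; rewrite /gram big_ord1 !mxE.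
Qed.

Lemma gram0 p : gram (0 : 'M[X -> C]_(p, n)) = 0.
Proof.
by apply/funext => u; apply/funext => v; rewrite /gram big1 // => i _; rewrite !mxE mulr0.
Qed.

Lemma gram1 : gram (scalar_cst X 1%:M) = unitk.
Proof.
apply/funext => u; apply/funext => v; rewrite /gram (bigD1 u.2) //= big1.
  by rewrite !mxE eqxx addr0 conjc1 mul1r.
move=> i /negPf iu; rewrite !mxE iu.
by rewrite /cst mulr0n rmorph0 mul0r.
Qed.

Hypothesis uA : unital_subalgebra A.

Lemma lek_refl p (H : 'M[X -> C]_(p, n)) : (forall i j, A (H i j)) ->
  lek (gram H) (gram H).
Proof.
move=> AH; exists p, p, H, H, (scalar_cst X 1%:M); split => //.
  exact/good_cst/bounded_by1.
by apply: evmx_inj => x; rewrite evmx_mul evmx_cst mul1mx.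
Qed.

(** Two realizations of the middle kernel differ by a scalar contraction, which is
    inserted between the two good matrices. *)
Lemma lek_trans k2 k1 k3 : lek k1 k2 -> lek k2 k3 -> lek k1 k3.
Proof.
case=> p [q [G [H [g [gg AH GH <- HK]]]]] [p' [q' [G' [H' [g' [gg' AH' GH' GK <-]]]]]].
rewrite -GK in HK; have [U U1 HU] := gram_eq HK.
exists p, q', G, H', (g *m (scalar_cst X U *m g')); split => //.
  by apply/good_mul/good_mul/gg' => //; exact: good_cst.
by rewrite -!mulmxA -GH' -HU.
Qed.

Lemma lek_add k1 k1' k2 k2' : lek k1 k1' -> lek k2 k2' -> lek (k1 + k2) (k1' + k2').
Proof.
case=> p [q [G [H [g [gg AH GH <- <-]]]]] [p' [q' [G' [H' [g' [gg' AH' GH' <- <-]]]]]].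
exists (p + p')%N, (q + q')%N, (col_mx G G'), (col_mx H H'), (block_mx g 0 0 g').
split; rewrite ?gram_col //.
- exact: good_dsum.
- by move=> i j; rewrite mxE; case: (fintype.split i).
- by rewrite mul_block_col !mul0mx addr0 add0r GH GH'.
Qed.

Lemma scalemxfAr p q r c (F : 'M[X -> C]_(p, q)) (G : 'M[X -> C]_(q, r)) :
  scalemxf c (F *m G) = F *m scalemxf c G.
Proof.
by apply: evmx_inj => x; rewrite !(evmxZ, evmx_mul) scalemxAr.
Qed.

Lemma scalemxf_entry p q c (F : 'M[X -> C]_(p, q)) i j :
  scalemxf c F i j = (fun x => c * F i j x).
Proof.
by apply/funext => x; have /matrixP/(_ i j) := evmxZ c F x; rewrite !mxE.
Qed.

Lemma lek_scale (r : R) k k' : 0 <= r -> lek k k' ->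
  lek (scalek r k) (scalek r k').
Proof.
move=> r0 [p [q [G [H [g [gg AH GH <- <-]]]]]].
exists p, q, (scalemxf (Num.sqrt r)%:C G), (scalemxf (Num.sqrt r)%:C H), g.
split; rewrite ?gram_scale ?sqnR ?sqr_sqrtr //.
- by move=> i j; rewrite scalemxf_entry; exact: alg_scale.
- by rewrite GH scalemxfAr.
Qed.

Lemma lek_ge0 p (H : 'M[X -> C]_(p, n)) : (forall i j, A (H i j)) -> lek 0 (gram H).
Proof.
move=> AH; exists p, p, 0, H, (scalar_cst X 0); split=> //.
- by apply: good_cst => v; rewrite mul0mx vsq0 mul1r vsq_ge0.
- by apply: evmx_inj => x; rewrite evmx_mul evmx_cst mul0mx evmx0.
- exact: gram0.
Qed.

Lemma lek_right k k' : lek k k' ->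
  exists q (H : 'M[X -> C]_(q, n)), (forall i j, A (H i j)) /\ k' = gram H.
Proof. by case=> p [q [G [H [g [? AH ? ? <-]]]]]; exists q, H. Qed.


Lemma lek_ge0_sqk z : rowA z -> lek 0 (sqk z).
Proof. by move=> Az; rewrite -gram_row; apply: lek_ge0 => i j; rewrite mxE. Qed.

Lemma lek_refl_sqk z : rowA z -> lek (sqk z) (sqk z).
Proof. by move=> Az; rewrite -gram_row; apply: lek_refl => i j; rewrite mxE. Qed.

Lemma lek_refl0 : lek 0 0.
Proof. by rewrite -(gram0 0); apply: lek_refl => -[]. Qed.

Lemma lek_addr k k1 k2 : lek k k1 -> lek 0 k2 -> lek k (k1 + k2).
Proof. by move=> h1 h2; rewrite -[k]addr0; exact: lek_add. Qed.

Lemma rowA_act a z : A a -> rowA z -> rowA (actr a z).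
Proof. by move=> Aa Az b; exact: alg_mul. Qed.

Lemma rowA_add z w : rowA z -> rowA w -> rowA (fun u => z u + w u).
Proof. by move=> Az Aw b; exact: alg_add. Qed.

Lemma rowA_scale c z : rowA z -> rowA (fun u => c * z u).
Proof. by move=> Az b; exact: alg_scale. Qed.

Lemma rowA_sum (I : Type) (r : seq I) (z : I -> Y -> C) :
  (forall i, rowA (z i)) -> rowA (fun u => \sum_(i <- r) z i u).
Proof. by move=> Az b; apply: alg_sum => // i; exact: Az. Qed.

Lemma lek_col2 a b z : A a -> A b -> rowA z ->
  (forall x, sqn (a x) + sqn (b x) <= 1) ->
  lek (sqk (actr a z) + sqk (actr b z)) (sqk z).
Proof.
move=> Aa Ab Az ab; rewrite -!gram_row -gram_col.
exists (1 + 1)%N, 1%N, (col_mx (rowmx (actr a z)) (rowmx (actr b z))), (rowmx z), (col2 a b).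
split => //; first exact: good_col.
  by move=> i j; rewrite mxE; exact: Az.
apply/matrixP => i j; rewrite mxE [RHS]mxE big_ord1 !mxE.
by case: splitP => k; rewrite !ord1 => ik; rewrite !mxE -val_eqE /= ik.
Qed.

Lemma lek_row2 a b z w : A a -> A b -> rowA z -> rowA w ->
  (forall x, sqn (a x) + sqn (b x) <= 1) ->
  lek (sqk (fun u => actr a z u + actr b w u)) (sqk z + sqk w).
Proof.
move=> Aa Ab Az Aw ab; rewrite -!gram_row -gram_col.
exists 1%N, (1 + 1)%N, (rowmx (fun u => actr a z u + actr b w u)),
  (col_mx (rowmx z) (rowmx w)), (row2 a b).
split => //; first exact: good_row.
  by move=> i j; rewrite mxE; case: (fintype.split i) => k; rewrite mxE.
apply/matrixP => i j; rewrite mxE [RHS]mxE (@big_split_ord _ _ _ 1 1) /=.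
by rewrite !big_ord1 col_mxEu col_mxEd !mxE.
Qed.

Lemma unitk_sum : unitk = \sum_b sqk (fun u => (u.2 == b)%:R).
Proof.
apply/funext => u; apply/funext => v; rewrite !fct_sumE (bigD1 u.2) //= big1.
  by rewrite /sqk /unitk eqxx conjc1 mul1r addr0 eq_sym.
by move=> i /negPf iu; rewrite /sqk eq_sym iu rmorph0 mul0r.
Qed.

Lemma rowA_unit b : rowA (fun u => (u.2 == b)%:R).
Proof. by move=> d; exact: alg_cst. Qed.

Lemma lek_refl_unitk : lek unitk unitk.
Proof.
by rewrite -gram1; apply: lek_refl => i j; rewrite mxE; exact: alg_cst.
Qed.

Lemma lek_unitk (a b : R) : 0 <= a -> a <= b -> lek (scalek a unitk) (scalek b unitk).
Proof.
move=> a0 ab.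
have -> : scalek b unitk = scalek a unitk + scalek (b - a) unitk.
  apply/funext => u; apply/funext => v; rewrite !fctE /scalek.
  by rewrite -mulrDl -rmorphD subrKC.
apply: lek_addr; first exact/lek_scale/lek_refl_unitk.
have -> : 0 = scalek (b - a) 0 :> kernel.
  by apply/funext => u; apply/funext => v; rewrite /scalek mulr0.
apply: lek_scale; first by rewrite subr_ge0.
by rewrite -gram1; apply: lek_ge0 => i j; rewrite mxE; exact: alg_cst.
Qed.

End Kernel.

(** * Cancellation *)

Section Cancellation.
Context {R : realType} {X : topologicalType} {n : nat}.
Variable A : set (X -> R[i]).
Local Notation C := R[i].
Local Notation Y := (X * 'I_n)%type.
Local Notation kernel := (Y -> Y -> C).
Hypothesis uA : unital_subalgebra A.
Local Notation lek := (@lek R X n A).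
Local Notation rowA := (@rowA R X n A).
Local Notation posk := (@posk R X n A).
Local Notation unitk := (@unitk R X n).

Lemma scalekB r (k k' : kernel) : scalek r (k - k') = scalek r k - scalek r k'.
Proof. by apply/funext => u; apply/funext => v; rewrite /scalek !fctE mulrBr. Qed.

Lemma scale0k (k : kernel) : scalek 0 k = 0.
Proof. by apply/funext => u; apply/funext => v; rewrite /scalek mul0r. Qed.

Lemma scalekA r s (k : kernel) : scalek r (scalek s k) = scalek (r * s) k.
Proof. by apply/funext => u; apply/funext => v; rewrite /scalek mulrA -rmorphM. Qed.

Lemma scalekDl r s (k : kernel) : scalek (r + s) k = scalek r k + scalek s k.
Proof. by apply/funext => u; apply/funext => v; rewrite /scalek !fctE -mulrDl -rmorphD. Qed.

Lemma scale1k (k : kernel) : scalek 1 k = k.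
Proof. by apply/funext => u; apply/funext => v; rewrite /scalek mul1r. Qed.

Lemma posk_lek k k' : lek k k' -> posk (k' - k).
Proof. by move=> kk'; exists k'; rewrite opprB addrC subrK. Qed.

Lemma posk_add k k' : posk k -> posk k' -> posk (k + k').
Proof.
move=> [a ha] [b hb]; exists (a + b); rewrite opprD addrACA; exact: lek_add.
Qed.

Lemma posk0 : posk 0.
Proof. by have := posk_lek (lek_refl0 A); rewrite subr0. Qed.

Lemma posk_sum (I : Type) (r : seq I) (k : I -> kernel) :
  (forall i, posk (k i)) -> posk (\sum_(i <- r) k i).
Proof.
move=> hk; elim: r => [|i r IH]; first by rewrite big_nil; exact: posk0.
by rewrite big_cons; exact: posk_add.
Qed.

Lemma posk_scale r k : 0 <= r -> posk k -> posk (scalek r k).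
Proof.
by move=> r0 [a ha]; exists (scalek r a); rewrite -scalekB; exact: lek_scale.
Qed.

Lemma posk_sqk z : rowA z -> posk (sqk z).
Proof. by move=> Az; rewrite -[sqk z]subr0; exact/posk_lek/lek_ge0_sqk. Qed.

Lemma posk_unitk r : 0 <= r -> posk (scalek r unitk).
Proof.
move=> r0; have := posk_lek (lek_unitk uA (lexx 0) r0).
by rewrite scale0k subr0.
Qed.

Hypothesis bA : forall f, A f -> exists2 M : R, 0 <= M & forall x, sqn (f x) <= M.

(** The unit kernel is an order unit: every Gram kernel lies below a multiple of
    it.  This is what allows the common part to be absorbed after cancellation. *)
Definition order_bounded (k : kernel) := exists2 K : R, 0 <= K & lek k (scalek K unitk).

Lemma order_bounded_add k k' :
  order_bounded k -> order_bounded k' -> order_bounded (k + k').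
Proof.
move=> [a a0 ha] [b b0 hb]; exists (a + b); first exact: addr_ge0.
by rewrite scalekDl; exact: lek_add.
Qed.

Lemma order_bounded_scale r k : 0 <= r -> order_bounded k -> order_bounded (scalek r k).
Proof.
move=> r0 [a a0 ha]; exists (r * a); first exact: mulr_ge0.
by rewrite -scalekA; exact: lek_scale.
Qed.

Lemma order_bounded_le k k' : lek k k' -> order_bounded k' -> order_bounded k.
Proof. by move=> kk' [a a0 ha]; exists a => //; exact: lek_trans ha. Qed.

Lemma order_bounded0 : order_bounded 0.
Proof. by exists 0 => //; rewrite scale0k; exact: lek_refl0. Qed.

Lemma sqk_scale (r : R) (z : Y -> C) :
  sqk (fun u => r%:C * z u) = scalek (r ^+ 2) (sqk z).
Proof.
apply/funext => u; apply/funext => v.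
by rewrite /sqk /scalek conjcM conjcR rmorphXn; ring.
Qed.

Lemma sqk0 : sqk (fun=> 0 : C) = 0 :> kernel.
Proof. by apply/funext => u; apply/funext => v; rewrite /sqk mulr0. Qed.

Lemma order_bounded_act a z : A a -> rowA z -> order_bounded (sqk z) ->
  order_bounded (sqk (actr a z)).
Proof.
move=> Aa Az hz; have [M M0 aM] := bA Aa.
pose s := Num.sqrt (M + 1).
have s2 : s ^+ 2 = M + 1 by rewrite sqr_sqrtr ?addr_ge0.
have s0 : 0 < s by rewrite sqrtr_gt0 ltr_wpDl.
have := @lek_col2 _ _ n A (fun x => s^-1%:C * a x) (fun=> 0) z.
move=> /(_ (alg_scale uA _ Aa) (alg_cst uA _) Az) H.
have {}H : lek (sqk (fun u => s^-1%:C * actr a z u)) (sqk z).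
  have -> : sqk (fun u => s^-1%:C * actr a z u) =
      sqk (actr (fun x => s^-1%:C * a x) z) + sqk (actr (fun=> 0 : C) z).
    rewrite [X in _ + X](_ : _ = 0) ?addr0; last first.
      by rewrite -sqk0; congr sqk; apply/funext => u; rewrite /actr mul0r.
    by congr sqk; apply/funext => u; rewrite /actr mulrA.
  apply: H => x; rewrite sqn0 addr0 sqnM sqnR exprVn s2.
  rewrite mulrC ler_pdivrMr ?ltr_wpDl // mul1r.
  by rewrite (le_trans (aM x)) // lerDl.
have -> : sqk (actr a z) = scalek (s ^+ 2) (sqk (fun u => s^-1%:C * actr a z u)).
  by rewrite sqk_scale scalekA exprVn mulfV ?scale1k // sqrf_eq0 gt_eqF.
apply: order_bounded_scale; first exact: sqr_ge0.
exact: order_bounded_le hz.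
Qed.

(** Parallelogram law: [|z + w|^2] becomes [2 |z|^2 + 2 |w|^2] after adding
    [|z - w|^2]. *)
Lemma order_bounded_sqk_add z w : rowA z -> rowA w -> order_bounded (sqk z) ->
  order_bounded (sqk w) -> order_bounded (sqk (fun u => z u + w u)).
Proof.
move=> Az Aw hz hw.
have Ad : rowA (fun u => z u + (-1) * w u).
  by apply: rowA_add => //; exact: rowA_scale.
have := lek_addr (lek_refl_sqk (rowA_add uA Az Aw)) (lek_ge0_sqk Ad).
move=> /order_bounded_le; apply.
have -> : sqk (fun u => z u + w u) + sqk (fun u => z u + (-1) * w u) =
    scalek 2 (sqk z) + scalek 2 (sqk w).
  apply/funext => u; apply/funext => v.
  rewrite !fctE /sqk /scalek !(conjcD, conjcM, conjcN) rmorph1 rmorph_nat.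
  by ring.
by apply: order_bounded_add; apply: order_bounded_scale.
Qed.

Lemma order_bounded_sqk z : rowA z -> order_bounded (sqk z).
Proof.
move=> Az; pose e b : Y -> C := fun u => (u.2 == b)%:R.
have He b : order_bounded (sqk (e b)).
  exists 1 => //; rewrite scale1k unitk_sum (bigD1 b) //=.
  apply: lek_addr; first exact: (lek_refl_sqk (rowA_unit uA b)).
  elim/big_rec : _ => [|d k _ hk]; first exact: lek_refl0.
  rewrite addrC.
  apply: lek_addr => //; exact: (lek_ge0_sqk (rowA_unit uA d)).
have -> : z = (fun u => \sum_b actr (fun x => z (x, b)) (e b) u).
  apply/funext => u; rewrite (bigD1 u.2) //= big1.
    by rewrite /actr /e eqxx mulr1 addr0; case: u.
  by move=> i /negPf iu; rewrite /actr /e eq_sym iu mulr0.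
have zA b : rowA (actr (fun x => z (x, b)) (e b)).
  exact: (rowA_act uA (Az b) (rowA_unit uA b)).
elim: (index_enum _) => [|b s IH].
  rewrite (_ : (fun u => _) = fun=> 0); last by apply/funext => u; rewrite big_nil.
  by rewrite sqk0; exact: order_bounded0.
rewrite (_ : (fun u => _) = fun u => actr (fun x => z (x, b)) (e b) u +
  \sum_(j <- s) actr (fun x => z (x, j)) (e j) u); last first.
  by apply/funext => u; rewrite big_cons.
apply: order_bounded_sqk_add => //; first exact: rowA_sum.
exact: (order_bounded_act (Az b) (rowA_unit uA b) (He b)).
Qed.

Lemma gram_sum p (F : 'M[X -> C]_(p, n)) :
  gram F = \sum_k sqk (fun u => F k u.2 u.1).
Proof. by apply/funext => u; apply/funext => v; rewrite !fct_sumE. Qed.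

Lemma order_bounded_gram p (F : 'M[X -> C]_(p, n)) :
  (forall i j, A (F i j)) -> order_bounded (gram F).
Proof.
move=> AF; rewrite gram_sum; elim/big_rec: _ => [|k K _ hK].
  exact: order_bounded0.
by apply: order_bounded_add => //; apply: order_bounded_sqk => b; exact: AF.
Qed.

(** The common summand is used up and returned by each copy of the inequality, so
    one copy of it serves for [N] copies of [f] and [g]. *)
Lemma lek_cancel k f g : lek f f -> lek g g -> lek k k -> lek (k + f) (k + g) ->
  forall N, lek (k + f *+ N) (k + g *+ N).
Proof.
move=> ff gg kk kfg; elim=> [|N IH]; first by rewrite !mulr0n !addr0.
have ggN : lek (g *+ N) (g *+ N).
  elim: (N) => [|m IHm]; first by rewrite mulr0n; exact: lek_refl0.
  by rewrite mulrS; exact: lek_add.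
rewrite !mulrSr !addrA; apply: (lek_trans (k2 := k + g *+ N + f)).
  exact: lek_add.
by have := lek_add kfg ggN; rewrite (addrAC k f) (addrAC k g).
Qed.

(** Dividing [k + N f <= k + N g] by [N] replaces [k <= K] by [K / N], which fits
    into the gap between [r] and [s]. *)
Lemma good_of_posk p (F : 'M[X -> C]_(p, n)) (r s : R) : (forall i j, A (F i j)) ->
  0 <= r -> r < s -> posk (scalek r unitk - gram F) ->
  exists2 G, good A G & F = scalemxf (Num.sqrt s)%:C G.
Proof.
move=> AF r0 rs [k]; rewrite opprB => hk.
have [q [H [AH kH]]] := lek_right hk.
have rr : lek (scalek r unitk) (scalek r unitk).
  exact/lek_scale/lek_refl_unitk.
have FF : lek (gram F) (gram F) by exact: lek_refl.
have kk : lek k k by rewrite kH; exact: lek_refl.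
have kF : lek (k + gram F) (k + scalek r unitk).
  by have := lek_add hk rr; rewrite addrA subrK.
have [K K0 hK] : order_bounded k by rewrite kH; exact: order_bounded_gram.
pose N := (Num.truncn (K / (s - r))).+1.
have N0 : 0 < N%:R :> R by rewrite ltr0n.
have KN : K <= N%:R * (s - r).
  rewrite -ler_pdivrMr ?subr_gt0 //; exact/ltW/truncnS_gt.
have mulrnk (h : kernel) m : h *+ m = scalek m%:R h.
  apply/funext => u; apply/funext => v; rewrite /scalek rmorph_nat mulr_natl.
  by elim: m => [|m IH]; rewrite ?mulr0n // !mulrSr -IH.
have NF : lek (gram F *+ N) (scalek (N%:R * s) unitk).
  apply: (lek_trans (k2 := k + gram F *+ N)).
    rewrite addrC; apply: lek_addr; last by rewrite kH; exact: lek_ge0.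
    elim: N {N0 KN} => [|m IH]; first by rewrite mulr0n; exact: lek_refl0.
    by rewrite mulrS; exact: lek_add.
  apply: (lek_trans (lek_cancel FF rr kk kF N)).
  apply: (lek_trans (k2 := scalek K unitk + scalek r unitk *+ N)).
    apply: lek_add => //; rewrite mulrnk; exact: lek_scale.
  rewrite mulrnk scalekA -scalekDl; apply: lek_unitk => //.
    by rewrite addr_ge0 // mulr_ge0.
  by rewrite -lerBrDr -mulrBr.
have {NF} : lek (gram F) (scalek s unitk).
  have := lek_scale uA (_ : 0 <= N%:R^-1) NF; rewrite mulrnk !scalekA.
  rewrite mulVf ?gt_eqF // mulrA mulVf ?gt_eqF // mul1r scale1k; apply.
  by rewrite invr_ge0 ltW.
have s0 : 0 <= s by rewrite (le_trans r0) ?ltW.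
have -> : scalek s unitk = gram (scalemxf (Num.sqrt s)%:C (scalar_cst X 1%:M)).
  by rewrite gram_scale sqnR sqr_sqrtr // gram1.
move=> [a [b [G0 [H0 [g [gg AH0 GH /esym /gram_eq [U U1 FU] /gram_eq [V V1 HV]]]]]]].
exists (scalar_cst X U *m g *m scalar_cst X V).
  by apply/good_mul/good_cst/V1/good_mul/gg; exact: good_cst.
rewrite FU GH HV -!scalemxfAr !mulmxA; congr scalemxf.
by apply: evmx_inj => x; rewrite !evmx_mul !evmx_cst mulmx1.
Qed.

End Cancellation.

(** * Moduli of invertible elements *)

Section Continuity.
Context {R : realType} {X : topologicalType}.
Local Notation C := R[i].

Lemma normE (z : C) : `|z| = (Normc.normc z)%:C.
Proof. by []. Qed.

Lemma normc_Re (z : C) : `|complex.Re z| <= Normc.normc z.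
Proof.
case: z => a b /=; rewrite -sqrtr_sqr ler_wsqrtr // lerDl; exact: sqr_ge0.
Qed.

Lemma normc_Im (z : C) : `|complex.Im z| <= Normc.normc z.
Proof.
case: z => a b /=; rewrite -sqrtr_sqr ler_wsqrtr // lerDr; exact: sqr_ge0.
Qed.

Lemma continuous_part (h : C -> R) (f : X -> C) :
  (forall z w, `|h z - h w| <= Normc.normc (z - w)) ->
  continuous (f : X -> C^o) -> continuous (fun x => h (f x)).
Proof.
move=> hL cf x; apply/cvgrPdist_lt => e e0.
have := cf x => /cvgrPdist_lt/(_ e%:C); rewrite ltcR => /(_ e0).
apply: filterS => y; rewrite normE ltcR; exact: le_lt_trans.
Qed.

Lemma continuous_sqn (f : X -> C) :
  continuous (f : X -> C^o) -> continuous (fun x => sqn (f x)).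
Proof.
move=> cf x; apply: cvgD.
  apply: cvgM; apply: (@continuous_part (@complex.Re R)) => //;
    by move=> z w; rewrite -raddfB; exact: normc_Re.
apply: cvgM; apply: (@continuous_part (@complex.Im R)) => //;
  by move=> z w; rewrite -raddfB; exact: normc_Im.
Qed.

Lemma continuous_bounded (v : X -> R) : compact [set: X] -> continuous v ->
  exists2 M, 0 <= M & forall x, v x <= M.
Proof.
move=> cX cv; have : compact (v @` [set: X]).
  by apply: continuous_compact => //; exact: continuous_subspaceT.
move=> /compact_bounded [M [_ hM]]; exists (Num.max (M + 1) 0).
  by rewrite le_max lexx orbT.
move=> x; rewrite le_max (le_trans (ler_norm _)) //.
by apply: hM; [rewrite ltrDl|exists x].
Qed.

End Continuity.

Section Approximation.
Context {R : realType} {X : topologicalType}.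
Variable A : set (X -> R[i]).
Local Notation C := R[i].

Definition modulus_approx := forall (v : X -> R) (B e : R),
  continuous v -> (forall x, 0 <= v x <= B) -> 0 < e ->
  exists c c', [/\ A c, A c', forall x, c x * c' x = 1 &
    forall x, v x <= sqn (c x) <= v x + e].

(** Approximate half the logarithm of [v + e / 2], which is continuous because
    [v + e / 2] is bounded away from zero; the additive error [h] in the logarithm
    becomes a factor [1 + t] on the squared modulus. *)
Lemma logmodular_modulus_approx : logmodular A -> modulus_approx.
Proof.
move=> [_ dA] v B e cv vB e0.
pose u x := v x + e / 2.
have u0 x : 0 < u x by rewrite /u; have /andP[] := vB x; lra.
pose w x := ln (u x) / 2.
have cu : continuous w.
  move=> x; apply: cvgM; last exact: cvg_cst.
  apply: (@continuous_comp _ _ _ u (@ln R)).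
    by apply: cvgD; [exact: cv|exact: cvg_cst].
  exact: continuous_ln.
have {dA} := dA _ cu.
pose K := Num.max B 0 + e.
have K0 : 0 < K by rewrite /K ltr_wpDl // le_max lexx orbT.
pose t := e / (4 * K).
have t0 : 0 < t by rewrite divr_gt0 // mulr_gt0.
pose h := ln (1 + t) / 2.
have h0 : 0 < h by rewrite divr_gt0 // ln_gt0 // ltrDl.
move=> /(_ [set g | forall x, `|w x - g x| < h]) [].
  apply/uniform_nbhs; exists [set xy | ball xy.1 h xy.2]; split.
    exact: (entourage_ball _ (PosNum h0)).
  by move=> g /= gh x; exact: gh.
move=> _ [[a [Aa [b Ab ab]] <-]] /= wa.
have abx x : a x * b x = 1 by have /(congr1 (@^~ x)) := ab.
exists a, b; split => // x.
have na0 : 0 < Normc.normc (a x).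
  rewrite lt_neqAle eq_sym; apply/andP; split; last first.
    by case: (a x) => ? ?; exact: sqrtr_ge0.
  apply/eqP => /Normc.eq0_normc ax; have := abx x; rewrite ax mul0r.
  by move=> /eqP; rewrite eq_sym oner_eq0.
have hE : expR (h + h) = 1 + t by rewrite -splitr lnK // posrE ltr_wpDl.
have uE : expR (w x + w x) = u x by rewrite -splitr lnK // posrE.
have lE : expR (ln (Normc.normc (a x)) + ln (Normc.normc (a x))) = sqn (a x).
  by rewrite expRD lnK // -normc_sqr.
have := wa x; rewrite ltr_norml => /andP[].
set l := ln _ in lE *; move=> wa1 wa2.
have ule : sqn (a x) <= u x * (1 + t).
  by rewrite -lE -uE -hE -expRD ler_expR; lra.
have leu : u x <= sqn (a x) * (1 + t).
  by rewrite -lE -uE -hE -expRD ler_expR; lra.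
have Kt : K * t = e / 4 by rewrite /t; field; rewrite gt_eqF.
have uK : u x <= K.
  have /andP[_ vb] := vB x; have Bm : B <= Num.max B 0 by rewrite le_max lexx.
  by rewrite /u /K; lra.
have ut : u x * t <= e / 4 by rewrite -Kt ler_wpM2r // ltW.
have uxE : u x = v x + e / 2 by [].
apply/andP; split; last by rewrite mulrDr in ule; lra.
rewrite leNgt; apply/negP => sv.
have : sqn (a x) * t <= u x * t by rewrite ler_wpM2r ?ltW //; lra.
by rewrite mulrDr in leu; lra.
Qed.

End Approximation.

(** * Long columns and rows *)

Section Long.
Context {R : realType} {X : topologicalType} {n : nat}.
Variable A : set (X -> R[i]).
Local Notation C := R[i].
Local Notation Y := (X * 'I_n)%type.
Local Notation kernel := (Y -> Y -> C).
Hypothesis uA : unital_subalgebra A.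
Hypothesis mA : modulus_approx A.
Local Notation rowA := (@rowA R X n A).
Local Notation posk := (@posk R X n A).

Lemma alg_continuous_sqn f : A f -> continuous (fun x => sqn (f x)).
Proof. by move=> Af; apply: continuous_sqn; case: uA => + _ _ _; exact. Qed.

Lemma posk_contraction (r : R) a z : 0 < r -> A a -> rowA z ->
  (forall x, sqn (a x) <= r) -> posk (scalek r (sqk z) - sqk (actr a z)).
Proof.
move=> r0 Aa Az ar; pose s := Num.sqrt r.
have s2 : s ^+ 2 = r by rewrite sqr_sqrtr // ltW.
have s0 : 0 < s by rewrite sqrtr_gt0.
have := @lek_col2 _ _ n A (fun x => s^-1%:C * a x) (fun=> 0) z
  (alg_scale uA _ Aa) (alg_cst uA _) Az.
have h x : sqn (s^-1%:C * a x) + sqn (0 : C) <= 1.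
  rewrite sqn0 addr0 sqnM sqnR exprVn s2.
  by rewrite mulrC ler_pdivrMr // mul1r.
move=> /(_ h) /posk_lek /(posk_scale uA (ltW r0)); congr posk.
have s0' : s%:C != 0 by rewrite -(rmorph0 (real_complex R)) (inj_eq (@complexI R)) gt_eqF.
apply/funext => u; apply/funext => v.
rewrite /scalek !fctE /sqk /actr !conjcM !conjcR -s2 rmorphXn fmorphV rmorph0.
by field.
Qed.

Lemma posk_col2 a b c c' z : A a -> A b -> A c -> A c' -> rowA z ->
  (forall x, c x * c' x = 1) -> (forall x, sqn (a x) + sqn (b x) <= sqn (c x)) ->
  posk (sqk (actr c z) - sqk (actr a z) - sqk (actr b z)).
Proof.
move=> Aa Ab Ac Ac' Az cc abc.
have := @lek_col2 _ _ n A _ _ (actr c z) (alg_mul uA Aa Ac') (alg_mul uA Ab Ac')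
  (rowA_act uA Ac Az).
have h x : sqn (a x * c' x) + sqn (b x * c' x) <= 1.
  rewrite !sqnM -mulrDl -(@sqn1 R) -(cc x) sqnM.
  by rewrite ler_wpM2r ?sqn_ge0.
move=> /(_ h) /posk_lek; rewrite opprD addrA; congr posk.
have E d : actr (fun x => d x * c' x) (actr c z) = actr d z.
  apply/funext => u; rewrite /actr -[d u.1 in RHS]mulr1 -(cc u.1); ring.
by rewrite !E.
Qed.

Lemma merge_moduli a b (e : R) : A a -> A b -> 0 < e ->
  (exists B, forall x, sqn (a x) + sqn (b x) <= B) ->
  exists c c', [/\ A c, A c', forall x, c x * c' x = 1 &
    forall x, sqn (a x) + sqn (b x) <= sqn (c x) <= sqn (a x) + sqn (b x) + e].
Proof.
move=> Aa Ab e0 [B hB]; apply: (mA (B := B)) => //.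
  move=> x; apply: cvgD; exact: alg_continuous_sqn.
by move=> x; rewrite hB addr_ge0 ?sqn_ge0.
Qed.

(** The first two entries of a column are replaced by a single invertible
    element with nearly the same modulus, at the cost of part of the slack [e]. *)
Lemma posk_col (I : Type) (s : seq I) (a : I -> X -> C) a0 (r e : R) z :
  (forall i, A (a i)) -> A a0 -> rowA z -> 0 < e ->
  (forall x, sqn (a0 x) + \sum_(i <- s) sqn (a i x) + e <= r) ->
  posk (scalek r (sqk z) - sqk (actr a0 z) - \sum_(i <- s) sqk (actr (a i) z)).
Proof.
move=> Aa + Az; elim: s a0 e => [|i s IH] a0 e A0 e0 h.
  rewrite big_nil subr0; case: (pselect (exists x : X, True)) => [[x _]|nX].
    apply: posk_contraction => //.
      by have := h x; rewrite big_nil addr0; have := sqn_ge0 (a0 x); lra.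
    by move=> y; have := h y; rewrite big_nil addr0; lra.
  have -> : scalek r (sqk z) - sqk (actr a0 z) = 0.
    by apply/funext => -[x]; case: nX; exists x.
  exact: posk0.
have e2 : 0 < e / 2 by rewrite divr_gt0.
have s0 x : 0 <= \sum_(j <- s) sqn (a j x) by apply: sumr_ge0 => j _; exact: sqn_ge0.
have [|c [c' [Ac Ac' cc hc]]] := merge_moduli A0 (Aa i) e2.
  by exists r => x; have := h x; rewrite big_cons; have := s0 x; lra.
have hc1 x : sqn (a0 x) + sqn (a i x) <= sqn (c x) by case/andP: (hc x).
have h1 := posk_col2 A0 (Aa i) Ac Ac' Az cc hc1.
have h2 x : sqn (c x) + \sum_(j <- s) sqn (a j x) + e / 2 <= r.
  by have := h x; rewrite big_cons; have /andP[_] := hc x; lra.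
have := posk_add (IH c (e / 2) Ac e2 h2) h1; congr posk.
apply/funext => u; apply/funext => v; rewrite big_cons !fctE; ring.
Qed.

(** Dually, two terms of a combination are merged by writing
    [a z + b w = c ((a / c) z + (b / c) w)] with [|c|^2] close to
    [|a|^2 + |b|^2]. *)
Lemma posk_row (I : Type) (s : seq I) (a : I -> X -> C) (z : I -> Y -> C) a0 z0
    (r e : R) :
  (forall i, A (a i)) -> A a0 -> (forall i, rowA (z i)) -> rowA z0 -> 0 < e ->
  (forall x, sqn (a0 x) + \sum_(i <- s) sqn (a i x) + e <= r) ->
  posk (scalek r (sqk z0 + \sum_(i <- s) sqk (z i))
        - sqk (fun u => actr a0 z0 u + \sum_(i <- s) actr (a i) (z i) u)).
Proof.
move=> Aa + Az; elim: s a0 z0 e => [|i s IH] a0 z0 e A0 Az0 e0 h.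
  rewrite big_nil addr0; case: (pselect (exists x : X, True)) => [[x _]|nX].
    rewrite (_ : (fun u => _) = actr a0 z0); last first.
      by apply/funext => u; rewrite big_nil addr0.
    apply: posk_contraction => //.
      by have := h x; rewrite big_nil addr0; have := sqn_ge0 (a0 x); lra.
    by move=> y; have := h y; rewrite big_nil addr0; lra.
  set k := (X in posk X); have -> : k = 0.
    by apply/funext => -[x]; case: nX; exists x.
  exact: posk0.
have e2 : 0 < e / 2 by rewrite divr_gt0.
have s0 x : 0 <= \sum_(j <- s) sqn (a j x) by apply: sumr_ge0 => j _; exact: sqn_ge0.
have [|c [c' [Ac Ac' cc hc]]] := merge_moduli A0 (Aa i) e2.
  by exists r => x; have := h x; rewrite big_cons; have := s0 x; lra.
have h2 x : sqn (c x) + \sum_(j <- s) sqn (a j x) + e / 2 <= r.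
  by have := h x; rewrite big_cons; have /andP[_] := hc x; lra.
have r0 (x : X) : 0 < r.
  by have := h x; rewrite big_cons; have := s0 x; have := sqn_ge0 (a0 x);
    have := sqn_ge0 (a i x); lra.
have h1 x : sqn (a0 x * c' x) + sqn (a i x * c' x) <= 1.
  rewrite !sqnM -mulrDl -(@sqn1 R) -(cc x) sqnM.
  by rewrite ler_wpM2r ?sqn_ge0 //; case/andP: (hc x).
pose w u := actr (fun x => a0 x * c' x) z0 u + actr (fun x => a i x * c' x) (z i) u.
have Aw : rowA w.
  apply: (rowA_add uA); apply: (rowA_act uA) => //; exact: (alg_mul uA).
have hw : posk (sqk z0 + sqk (z i) - sqk w).
  exact: (posk_lek (lek_row2 (alg_mul uA A0 Ac') (alg_mul uA (Aa i) Ac') Az0 (Az i) h1)).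
have E u' : actr a0 z0 u' + \sum_(j <- i :: s) actr (a j) (z j) u'
    = actr c w u' + \sum_(j <- s) actr (a j) (z j) u'.
  rewrite big_cons addrA; congr (_ + _); rewrite /actr /w /actr.
  rewrite mulrDr -[a0 u'.1 in LHS]mulr1 -[a i u'.1 in LHS]mulr1 -(cc u'.1).
  ring.
clearbody w.
case: (pselect (exists x : X, True)) => [[x _]|nX]; last first.
  set k := (X in posk X); have -> : k = 0.
    by apply/funext => -[x]; case: nX; exists x.
  exact: posk0.
have := posk_add (IH c w (e / 2) Ac Aw e2 h2) (posk_scale uA (ltW (r0 x)) hw).
congr posk; apply/funext => u; apply/funext => v.
rewrite /sqk /scalek !fctE !E big_cons !fctE; ring.
Qed.

End Long.

(** * An approximate positive extension *)

(** Twice the real part of the inner product of two vectors. *)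
Definition crossk {R : realType} {Y : Type} (z w : Y -> R[i]) : Y -> Y -> R[i] :=
  fun u v => (z u)^*%C * w v + (w u)^*%C * z v.

(** The first order terms of the two factors cancel except for [e p]; here [s] is a
    convex combination of the weights and [p] the oscillation error. *)
Lemma second_order {R : realType} (e s p : R) : 0 < e -> e <= 1 -> 0 <= s ->
  s <= 1 -> 0 <= p ->
  (1 + e * (s + p) + e ^+ 2 / 4) * (1 - e * s + e ^+ 2) + e ^+ 2 / 2
    <= 1 + 2 * e * p + 3 * e ^+ 2.
Proof.
move=> e0 e1 s0 s1 p0.
have a1 : 0 <= e * p by rewrite mulr_ge0 // ltW.
have a2 : 0 <= e ^+ 2 by rewrite sqr_ge0.
have a3 : 0 <= e * s by rewrite mulr_ge0 // ltW.
have a4 : e * s <= e by rewrite ler_piMr // ltW.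
have a5 : e ^+ 2 <= e by rewrite expr2 ler_piMr // ltW.
have a6 : e ^+ 2 * (e * s) <= e ^+ 2 by rewrite ler_piMr //; lra.
have a7 : e * p * (1 - e * s + e ^+ 2) <= e * p * 2 by rewrite ler_wpM2l //; lra.
have a8 : e ^+ 2 / 4 * (1 - e * s + e ^+ 2) <= e ^+ 2 / 4 * 2.
  by rewrite ler_wpM2l ?divr_ge0 //; lra.
have a9 : 0 <= (e * s) ^+ 2 by rewrite sqr_ge0.
have E : (1 + e * (s + p) + e ^+ 2 / 4) * (1 - e * s + e ^+ 2) =
  1 - (e * s) ^+ 2 + e ^+ 2 + e ^+ 2 * (e * s) + e * p * (1 - e * s + e ^+ 2)
   + e ^+ 2 / 4 * (1 - e * s + e ^+ 2) by ring.
by rewrite E; lra.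
Qed.

Section Extension.
Context {R : realType} {X : topologicalType} {n : nat}.
Variable A : set (X -> R[i]).
Local Notation C := R[i].
Local Notation Y := (X * 'I_n)%type.
Local Notation kernel := (Y -> Y -> C).
Hypothesis uA : unital_subalgebra A.
Hypothesis mA : modulus_approx A.
Local Notation rowA := (@rowA R X n A).
Local Notation posk := (@posk R X n A).

Variables (J : nat) (phi : 'I_J -> X -> R) (c c' : 'I_J -> X -> C) (e : R).
Hypothesis J_gt0 : (0 < J)%N.
Hypothesis e_gt0 : 0 < e.
Hypothesis e_le1 : e <= 1.
Hypothesis phi_ge0 : forall j x, 0 <= phi j x.
Hypothesis phi_sum : forall x, \sum_j phi j x = 1.
Hypothesis Ac : forall j, A (c j).
Hypothesis Ac' : forall j, A (c' j).
Hypothesis cc' : forall j x, c j x * c' j x = 1.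
Hypothesis hc : forall j x,
  1 + e * phi j x <= sqn (c j x) <= 1 + e * phi j x + e ^+ 2.

(** Since [|c_j|^2] is about [1 + e phi_j], this is [e] times the value at [phi_j] of
    the derivative at 1 of [|a|^2 |-> |a z|^2]. *)
Definition testk j (z : Y -> C) : kernel := sqk (actr (c j) z) - sqk z.

Lemma phi_le1 j x : phi j x <= 1.
Proof.
rewrite -(phi_sum x) (bigD1 j) //= lerDl; apply: sumr_ge0 => i _; exact: phi_ge0.
Qed.

Lemma sqn_inv j x : sqn (c j x) * sqn (c' j x) = 1.
Proof. by rewrite -sqnM cc' sqn1. Qed.

Lemma sqn_inv_le1 j x : sqn (c' j x) <= 1.
Proof.
have /andP[h _] := hc j x; have := mulr_ge0 (ltW e_gt0) (phi_ge0 j x) => p0.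
by rewrite -(sqn_inv j x) ler_peMl ?sqn_ge0 //; lra.
Qed.

Lemma sqn_inv_le j x : sqn (c' j x) <= 1 - e * phi j x + e ^+ 2.
Proof.
have hs := sqn_inv j x; have /andP[h _] := hc j x.
have s0 := sqn_ge0 (c' j x); have p0 := phi_ge0 j x; have p1 := phi_le1 j x.
have ep0 : 0 <= e * phi j x by rewrite mulr_ge0 // ltW.
set s := sqn (c' j x) in hs s0 *; set t := e * phi j x in h ep0 *.
have st : s * (1 + t) <= 1 by rewrite -[leRHS]hs mulrC ler_wpM2r.
have t2 : t ^+ 2 <= e ^+ 2.
  by rewrite /t exprMn ler_piMr ?sqr_ge0 // expr_le1.
have H : 1 <= (1 - t + e ^+ 2) * (1 + t).
  have : 0 <= e ^+ 2 * t by rewrite mulr_ge0 ?sqr_ge0.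
  by rewrite !mulrDr !mulrDl; lra.
rewrite -(ler_pM2r (_ : 0 < 1 + t)); last by lra.
exact: le_trans H.
Qed.

(** [z] is recovered from [c_j z] by the contraction [c'_j]. *)
Lemma testk_ge0 j z : rowA z -> posk (testk j z).
Proof.
move=> Az; have := posk_contraction uA ltr01 (Ac' j) (rowA_act uA (Ac j) Az).
move=> /(_ (sqn_inv_le1 j)); rewrite scale1k; congr (posk (_ - sqk _)).
by apply/funext => u; rewrite /actr mulrA [c' _ _ * _]mulrC cc' mul1r.
Qed.

Lemma testk_le j z : rowA z -> posk (scalek (2 * e) (sqk z) - testk j z).
Proof.
move=> Az; have r0 : 0 < 1 + 2 * e by rewrite addr_gt0 ?mulr_gt0.
have hx x : sqn (c j x) <= 1 + 2 * e.
  have /andP[_] := hc j x; have := phi_le1 j x; have := e_gt0; have := e_le1; nra.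
have := posk_contraction uA r0 (Ac j) Az hx; congr posk.
by rewrite /testk scalekDl scale1k opprB [sqk z + scalek _ _]addrC addrA.
Qed.

Let Jr : R := J%:R.
Let Jr_gt0 : 0 < Jr. Proof. by rewrite ltr0n. Qed.

(** The column with entries [c_j / sqrt J] has squared modulus about [1 + e / J]. *)
Lemma testk_sum z : rowA z ->
  posk (scalek (e * (1 + 2 * Jr * e)) (sqk z) - \sum_j testk j z).
Proof.
move=> Az; pose s : C := ((Num.sqrt Jr)^-1)%:C.
have sE : sqn s = Jr^-1 by rewrite sqnR exprVn sqr_sqrtr // ltW.
have e20 : 0 < e ^+ 2 by rewrite exprn_gt0.
have := @posk_col _ _ n _ uA mA _ (index_enum 'I_J) (fun j x => s * c j x)
  (fun=> 0) (1 + e / Jr + 2 * e ^+ 2) (e ^+ 2) z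
  (fun j => alg_scale uA _ (Ac j)) (alg_cst uA _) Az e20.
have hs x : sqn (0 : C) + \sum_j sqn (s * c j x) + e ^+ 2 <= 1 + e / Jr + 2 * e ^+ 2.
  rewrite sqn0 add0r.
  have -> : \sum_j sqn (s * c j x) = Jr^-1 * \sum_j sqn (c j x).
    by rewrite mulr_sumr; apply: eq_bigr => j _; rewrite sqnM sE.
  have : \sum_j sqn (c j x) <= Jr + e + Jr * e ^+ 2.
    apply: (@le_trans _ _ (\sum_j (1 + e ^+ 2 + e * phi j x))).
      apply: ler_sum => j _; have /andP[_] := hc j x; lra.
    by rewrite big_split /= -mulr_sumr phi_sum sumr_const card_ord -mulr_natl -/Jr; lra.
  rewrite -(ler_pM2l (_ : 0 < Jr^-1)) ?invr_gt0 // => h.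
  have E : Jr^-1 * (Jr + e + Jr * e ^+ 2) = 1 + e / Jr + e ^+ 2.
    by field; rewrite gt_eqF.
  by move: h; rewrite E; lra.
move=> /(_ hs) /(posk_scale uA (ltW Jr_gt0)); congr posk.
apply/funext => u; apply/funext => v.
rewrite /scalek !fctE !fct_sumE.
have -> : \sum_j sqk (actr (fun x => s * c j x) z) u v
   = (Jr^-1)%:C * \sum_j sqk (actr (c j) z) u v.
  rewrite mulr_sumr; apply: eq_bigr => j _.
  by rewrite -sE sqnE /sqk /actr !conjcM; ring.
have -> : \sum_j testk j z u v = \sum_j sqk (actr (c j) z) u v - Jr%:C * sqk z u v.
  rewrite big_split /= sumrN sumr_const card_ord; congr (_ - _).
  by rewrite -mulr_natl rmorph_nat.
have -> : sqk (actr (fun=> 0 : C) z) u v = 0.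
  by rewrite /sqk /actr !mul0r mulr0.
set S := \sum_j _; set q := sqk z u v.
have Jc : J%:R != 0 :> C by rewrite pnatr_eq0 -lt0n.
rewrite !(rmorphD, rmorphM, rmorphXn, rmorph1, fmorphV, rmorph_nat).
by field.
Qed.

Section Upper.
Variables (f : X -> C) (M d : R) (y : 'I_J -> C).
Hypothesis Af : A f.
Hypothesis M_ge1 : 1 <= M.
Hypothesis fM : forall x, sqn (f x) <= M ^+ 2.
Hypothesis yM : forall j, sqn (y j) <= M ^+ 2.
Hypothesis d_ge0 : 0 <= d.
Hypothesis fy : forall j x,
  phi j x * complex.Re (f x) <= phi j x * (complex.Re (y j) + d).

(* Adding [M] makes the weights [lam j] nonnegative, and the factor [k] makes their
   sum at most 1, so that [b z] is a convex combination of the [(b / c_j) (c_j z)]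
   and of [b z] itself. *)
Let k : R := (4 * M * Jr)^-1.
Let lam j : R := 2 * k * (complex.Re (y j) + M).
Let lam0 : R := 1 - \sum_j lam j.
Let b x : C := 1 + (k * e)%:C * (f x + M%:C).

Let M_gt0 : 0 < M. Proof. exact: lt_le_trans ltr01 M_ge1. Qed.

Let k_gt0 : 0 < k. Proof. by rewrite invr_gt0 !mulr_gt0. Qed.

Let Jr_ge1 : 1 <= Jr. Proof. by rewrite ler1n. Qed.

Let kMJ : 4 * M * Jr * k = 1.
Proof. by rewrite mulfV // gt_eqF // !mulr_gt0. Qed.

Lemma Re_le (z : C) (N : R) : 0 <= N -> sqn z <= N ^+ 2 -> `|complex.Re z| <= N.
Proof.
move=> N0 h; rewrite -(@ler_pXn2r _ 2) ?nnegrE // real_normK ?num_real //.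
by apply: le_trans h; rewrite lerDl sqr_ge0.
Qed.

Let Re_y j : - M <= complex.Re (y j) <= M.
Proof. by rewrite -ler_norml; exact: Re_le (ltW M_gt0) (yM j). Qed.

Let lam_ge0 j : 0 <= lam j.
Proof.
rewrite /lam; have /andP[h _] := Re_y j.
by rewrite !mulr_ge0 ?(ltW k_gt0) //; lra.
Qed.

Let sum_lam : \sum_j lam j <= 1.
Proof.
apply: (@le_trans _ _ (\sum_(j < J) Jr^-1)).
  apply: ler_sum => j _; have /andP[_ h] := Re_y j.
  rewrite -(ler_pM2r Jr_gt0) mulVf ?gt_eqF // -kMJ /lam.
  have -> : 2 * k * (complex.Re (y j) + M) * Jr = (2 * Jr * k) * (complex.Re (y j) + M).
    ring.
  have -> : 4 * M * Jr * k = (2 * Jr * k) * (M + M) by ring.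
  by rewrite ler_pM2l ?lerD2r // !mulr_gt0.
by rewrite sumr_const card_ord -mulr_natl mulfV // gt_eqF.
Qed.

Let sig x := \sum_j lam j * phi j x.

Let sig_ge0 x : 0 <= sig x.
Proof. by apply: sumr_ge0 => j _; rewrite mulr_ge0. Qed.

Let weights_le x : lam0 + \sum_j lam j * sqn (c' j x) <= 1 - e * sig x + e ^+ 2.
Proof.
have : \sum_j lam j * sqn (c' j x) <= \sum_j lam j * (1 - e * phi j x + e ^+ 2).
  by apply: ler_sum => j _; rewrite ler_wpM2l // sqn_inv_le.
have -> : \sum_j lam j * (1 - e * phi j x + e ^+ 2)
    = (\sum_j lam j) * (1 + e ^+ 2) - e * sig x.
  rewrite /sig mulr_suml mulr_sumr -sumrB; apply: eq_bigr => j _; ring.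
have : (\sum_j lam j) * e ^+ 2 <= e ^+ 2 by rewrite ler_piMl ?sqr_ge0.
by rewrite /lam0 mulrDr mulr1; lra.
Qed.

Let Re_f x : 2 * k * (complex.Re (f x) + M) <= sig x + 2 * k * d.
Proof.
have h : complex.Re (f x) <= \sum_j phi j x * (complex.Re (y j) + d).
  rewrite -[leLHS]mul1r -(phi_sum x) mulr_suml; exact: ler_sum.
have -> : sig x + 2 * k * d =
    2 * k * (\sum_j phi j x * (complex.Re (y j) + d) + M).
  have -> : \sum_j phi j x * (complex.Re (y j) + d) =
      \sum_j phi j x * complex.Re (y j) + d.
    under eq_bigr => j _ do rewrite mulrDr.
    by rewrite big_split /= -mulr_suml phi_sum mul1r.
  have -> : sig x = 2 * k * (\sum_j phi j x * complex.Re (y j)) + 2 * k * M.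
    have -> : 2 * k * M = 2 * k * M * (\sum_j phi j x) by rewrite phi_sum mulr1.
    rewrite /sig !mulr_sumr -big_split /=.
    by apply: eq_bigr => j _; rewrite /lam; ring.
  by ring.
by rewrite ler_pM2l ?lerD2r // mulr_gt0.
Qed.

Let sqn_b x : sqn (b x) <= 1 + e * (sig x + 2 * k * d) + e ^+ 2 / 4.
Proof.
have kM : k ^+ 2 * (4 * M ^+ 2) <= 1 / 4.
  have h : 2 * M * k <= 1 / 2.
    have -> : 2 * M * k = Jr^-1 / 2.
      by rewrite /k; field; rewrite !gt_eqF.
    by rewrite ler_pM2r // invf_le1.
  have h0 : 0 <= 2 * M * k by rewrite !mulr_ge0 ?ltW.
  have -> : k ^+ 2 * (4 * M ^+ 2) = (2 * M * k) ^+ 2 by ring.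
  by nra.
have fxM : complex.Re (f x + M%:C) ^+ 2 + complex.Im (f x + M%:C) ^+ 2 <= 4 * M ^+ 2.
  have := fM x; have := Re_le (ltW M_gt0) (fM x); rewrite /sqn ler_norml.
  case: (f x) => p q /= /andP[h1 h2] h3; have := M_gt0; nra.
have bE : sqn (b x) = 1 + e * (2 * k * (complex.Re (f x) + M))
    + e ^+ 2 * (k ^+ 2 * (complex.Re (f x + M%:C) ^+ 2 + complex.Im (f x + M%:C) ^+ 2)).
  by rewrite /b /sqn; case: (f x) => p q /=; ring.
rewrite bE; have h1 := ler_wpM2l (ltW e_gt0) (Re_f x).
have h2 : k ^+ 2 * (complex.Re (f x + M%:C) ^+ 2 + complex.Im (f x + M%:C) ^+ 2) <= 1 / 4.
  by apply: le_trans kM; rewrite ler_wpM2l ?sqr_ge0.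
have h3 := ler_wpM2l (sqr_ge0 e) h2.
lra.
Qed.

Let mu : R := 1 + 4 * k * e * d + 3 * e ^+ 2.

(** Up to the oscillation error and terms of the second order, [|b|^2] is at most
    the weighted harmonic mean of 1 and the [|c_j|^2]. *)
Let harmonic_mean x :
  sqn (b x) * (lam0 + \sum_j lam j * sqn (c' j x)) + e ^+ 2 / 2 <= mu.
Proof.
have h1 := weights_le x; have h2 := sqn_b x; have s0 := sig_ge0 x.
have w0 : 0 <= lam0 + \sum_j lam j * sqn (c' j x).
  rewrite addr_ge0 ?subr_ge0 //; apply: sumr_ge0 => j _.
  by rewrite mulr_ge0 ?sqn_ge0.
have := ler_pM (sqn_ge0 (b x)) w0 h2 h1.
set W := _ * (lam0 + _); move=> hW.
have s1 : sig x <= 1.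
  apply: le_trans sum_lam; apply: ler_sum => j _.
  by rewrite ler_piMr // phi_le1.
have e0 := e_gt0; have e1 := e_le1.
set p := 2 * k * d; have p0 : 0 <= p by rewrite /p mulr_ge0 // mulr_ge0 // ltW.
have muE : mu = 1 + 2 * e * p + 3 * e ^+ 2 by rewrite /mu /p; ring.
have := second_order e0 e1 s0 s1 p0; rewrite -/p in hW.
by rewrite muE; lra.
Qed.

Let lam0_ge0 : 0 <= lam0. Proof. by rewrite subr_ge0. Qed.

Let Ab : A b.
Proof.
rewrite /b; apply: (alg_add uA (alg_cst uA 1)); apply: (alg_scale uA).
exact: (alg_add uA Af (alg_cst uA _)).
Qed.

(** The row inequality for [b z = lam0 b z + sum_j lam j (b / c_j) (c_j z)]. *)
Let posk_b z : rowA z ->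
  posk (scalek mu (sqk z + \sum_j scalek (lam j) (testk j z)) - sqk (actr b z)).
Proof.
move=> Az; have e2 : 0 < e ^+ 2 / 2 by rewrite divr_gt0 // exprn_gt0.
pose r j := Num.sqrt (lam j); pose r0 := Num.sqrt lam0.
have rr j : r j ^+ 2 = lam j by rewrite sqr_sqrtr.
have rr0 : r0 ^+ 2 = lam0 by rewrite sqr_sqrtr.
have rC j : (lam j)%:C = (r j)%:C * (r j)%:C :> C by rewrite -rmorphM -expr2 rr.
have rC0 : lam0%:C = r0%:C * r0%:C :> C by rewrite -rmorphM -expr2 rr0.
have Aa j : A (fun x => (r j)%:C * (b x * c' j x)).
  exact: (alg_scale uA _ (alg_mul uA Ab (Ac' j))).
have Aa0 : A (fun x => r0%:C * b x) by exact: alg_scale.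
have Azj j : rowA (fun u => (r j)%:C * actr (c j) z u).
  exact: (rowA_scale uA _ (rowA_act uA (Ac j) Az)).
have Az0 : rowA (fun u => r0%:C * z u) by exact: rowA_scale.
have hs x : sqn (r0%:C * b x) + \sum_j sqn ((r j)%:C * (b x * c' j x))
    + e ^+ 2 / 2 <= mu.
  have := harmonic_mean x; rewrite mulrDr mulr_sumr sqnM sqnR rr0 [_ * lam0]mulrC.
  congr (_ + _ + _ <= _); apply: eq_bigr => j _.
  by rewrite !sqnM sqnR rr; ring.
have := posk_row uA mA Aa Aa0 Azj Az0 e2 hs; congr posk.
have lamC : \sum_j (lam j)%:C = (1 - lam0%:C) :> C.
  by rewrite -rmorph_sum -(rmorph1 (real_complex R)) -rmorphB /lam0 subKr.
have bz : (fun u => actr (fun x => r0%:C * b x) (fun u => r0%:C * z u) u +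
    \sum_j actr (fun x => (r j)%:C * (b x * c' j x))
             (fun u => (r j)%:C * actr (c j) z u) u) = actr b z.
  apply/funext => u; transitivity ((lam0%:C + \sum_j (lam j)%:C) * (b u.1 * z u)).
    rewrite mulrDl mulr_suml; congr (_ + _); first by rewrite /actr rC0; ring.
    apply: eq_bigr => j _; rewrite rC /actr -[z u in RHS]mul1r -(cc' j u.1).
    ring.
  by rewrite lamC addrC subrK mul1r.
rewrite bz; congr (scalek _ _ - _).
under eq_bigr => j _ do rewrite sqk_scale rr.
rewrite sqk_scale rr0; apply/funext => u; apply/funext => v.
rewrite !fctE !fct_sumE /scalek /testk.
have -> : \sum_j (lam j)%:C * (sqk (actr (c j) z) - sqk z) u v =
   \sum_j (lam j)%:C * sqk (actr (c j) z) u v - (1 - lam0%:C) * sqk z u v.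
  rewrite -lamC mulr_suml -sumrB; apply: eq_bigr => j _.
  by rewrite !fctE mulrBr.
ring.
Qed.

(** Expand [|b z|^2 = |z|^2 + 2 k e Re<(f + M) z, z> + O(e^2)] in [posk_b] and
    divide by [k].  The constant [M] introduced to have positive weights leaves
    [M (sum_j T_j(z) - e |z|^2)], which is negligible by [testk_sum]. *)
Lemma testk_upper z : rowA z ->
  posk (\sum_j scalek (2 * complex.Re (y j)) (testk j z)
        + scalek (2 * e * (6 * d + 20 * M * Jr * e)) (sqk z)
        - scalek e (crossk z (actr f z))).
Proof.
move=> Az; have e0 := e_gt0; have e1 := e_le1.
have mu1 : 0 <= mu - 1.
  have -> : mu - 1 = 4 * k * e * d + 3 * e ^+ 2 by rewrite /mu; ring.
  by rewrite addr_ge0 // mulr_ge0 ?sqr_ge0 // !mulr_ge0 // ltW.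
pose L := \sum_j lam j.
have H1 := posk_b Az.
(* [H2] and [H4] trade the factor [mu] of [posk_b] for 3 (mu - 1) copies of
   [|z|^2]; [H3] is the square term of the expansion of [|b z|^2]. *)
have H2 : posk (scalek (mu - 1) (\sum_j scalek (lam j)
    (scalek (2 * e) (sqk z) - testk j z))).
  apply: (posk_scale uA mu1); apply: posk_sum => j.
  exact: (posk_scale uA (lam_ge0 j) (testk_le j Az)).
have Ag : A (fun x => f x + M%:C) by exact: (alg_add uA Af (alg_cst uA _)).
have H3 := posk_scale uA (sqr_ge0 (k * e)) (posk_sqk (rowA_act uA Ag Az)).
have L0 : 0 <= L by apply: sumr_ge0.
have L4 : 0 <= (mu - 1) * (2 - 2 * e * L).
  rewrite mulr_ge0 // subr_ge0 -mulrA ler_piMr //.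
  exact: mulr_ile1 (ltW e0) L0 e1 sum_lam.
have H4 := posk_scale uA L4 (posk_sqk Az).
have M2 : 0 <= 2 * M by rewrite mulr_ge0 // ltW.
have H5 := posk_scale uA M2 (testk_sum Az).
have k1 : 0 <= k^-1 by rewrite invr_ge0 ltW.
have := posk_add (posk_scale uA k1
  (posk_add (posk_add (posk_add H1 H2) H3) H4)) H5.
congr posk; apply/funext => u; apply/funext => v.
pose T0 := \sum_j (2 * complex.Re (y j))%:C * testk j z u v.
pose T1 := \sum_j testk j z u v.
have lamC j : (lam j)%:C = k%:C * (2 * complex.Re (y j))%:C + 2 * k%:C * M%:C :> C.
  by rewrite /lam !(rmorphM, rmorphD, rmorph_nat); ring.
have S1 : \sum_j (lam j)%:C * testk j z u v = k%:C * (T0 + 2 * M%:C * T1).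
  rewrite /T0 /T1 mulrDr !mulr_sumr -big_split; apply: eq_bigr => j _ /=.
  by rewrite lamC; ring.
have S2 : \sum_j (lam j)%:C * (scalek (2 * e) (sqk z) - testk j z) u v =
   2 * e%:C * L%:C * sqk z u v - k%:C * (T0 + 2 * M%:C * T1).
  rewrite -S1 rmorph_sum mulr_sumr mulr_suml -sumrB; apply: eq_bigr => j _.
  by rewrite !fctE /scalek !(rmorphM, rmorph_nat); ring.
have kC : k%:C != 0 :> C.
  by rewrite -(rmorph0 (real_complex R)) (inj_eq (@complexI R)) gt_eqF.
rewrite /scalek !fctE !fct_sumE S1 S2 -/T0 -/T1.
have -> : sqk (actr b z) u v = sqk z u v
   + (k * e)%:C * (crossk z (actr f z) u v + 2 * M%:C * sqk z u v)
   + ((k * e) ^+ 2)%:C * sqk (actr (fun x => f x + M%:C) z) u v.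
  rewrite /sqk /crossk /actr /b !(conjcM, conjcD, conjcR) rmorph1 rmorphXn.
  ring.
set q := sqk z u v; set cr := crossk _ _ u v; set g := sqk _ u v.
have kE : 4 * M%:C * J%:R * k%:C = 1 :> C.
  by have := congr1 (real_complex R) kMJ; rewrite !(rmorphM, rmorph_nat) rmorph1.
have JE : 4 * M%:C * J%:R = k%:C^-1 :> C by apply: (mulIf kC); rewrite kE mulVf.
have JE' : 40 * M%:C * J%:R = 10 * k%:C^-1 :> C by rewrite -JE; ring.
have muC : mu%:C = 1 + 4 * k%:C * e%:C * d%:C + 3 * e%:C ^+ 2 :> C.
  by rewrite /mu !(rmorphM, rmorphD, rmorphXn, rmorph_nat, rmorph1); ring.
have rE : (2 * e * (6 * d + 20 * M * Jr * e))%:C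
   = 12 * e%:C * d%:C + 10 * k%:C^-1 * e%:C ^+ 2 :> C.
  by rewrite -JE' !(rmorphM, rmorphD, rmorph_nat); ring.
have tE : (e * (1 + 2 * Jr * e))%:C * (2 * M)%:C = 2 * M%:C * e%:C + k%:C^-1 * e%:C ^+ 2 :> C.
  by rewrite -JE !(rmorphM, rmorphD, rmorph_nat, rmorph1); ring.
have -> : (2 * M)%:C * ((e * (1 + 2 * Jr * e))%:C * q - T1) =
    (2 * M%:C * e%:C + k%:C^-1 * e%:C ^+ 2) * q - 2 * M%:C * T1.
  by rewrite -tE !(rmorphM, rmorphD, rmorph_nat, rmorph1); ring.
rewrite rE.
have E1 : (k^-1)%:C = k%:C^-1 :> C by exact: fmorphV.
have E2 : (k * e)%:C = k%:C * e%:C :> C by exact: rmorphM.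
have E3 : ((k * e) ^+ 2)%:C = (k%:C * e%:C) ^+ 2 :> C by rewrite -E2; exact: rmorphXn.
have E4 : (mu - 1)%:C = mu%:C - 1 :> C by rewrite rmorphB rmorph1.
have E5 : ((mu - 1) * (2 - 2 * e * L))%:C = (mu%:C - 1) * (2 - 2 * e%:C * L%:C) :> C.
  transitivity ((mu - 1)%:C * (2 - 2 * e * L)%:C); first exact: rmorphM.
  by rewrite E4; congr (_ * _); rewrite rmorphB !rmorphM rmorph_nat.
rewrite {}E1 {}E3 {}E2 {}E5 {}E4 {}muC {rE tE JE JE' kE S1 S2}.
move: kC; move: (k%:C) (e%:C) (d%:C) (M%:C) (L%:C) q cr g T0 T1.
by move=> k' e' d' M' L' q' cr' g' T0' T1' kC; field.
Qed.

End Upper.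

End Extension.


(** * From scalar functions to matrices *)

Section Psd.
Local Open Scope sesquilinear_scope.
Context {R : realType}.
Local Notation C := R[i].

Lemma adj_trmxC p q (M : 'M[C]_(p, q)) : adj M = M ^t*.
Proof. by apply/matrixP => i j; rewrite !mxE. Qed.

(** [1 - N^* N] is positive semidefinite, so the spectral theorem provides a square
    root. *)
Lemma contraction_defect p q (N : 'M[C]_(p, q)) : bounded_by 1 N ->
  exists D : 'M[C]_q, adj D *m D = 1%:M - adj N *m N.
Proof.
move=> N1; set P := 1%:M - adj N *m N.
have adjP : adj P = P.
  by rewrite /P adjB adj_mul adjK /adj trmx1 map_mx1.
have Ph : P \is hermsymmx.
  by apply/is_hermitianmxP; rewrite expr0 scale1r -adj_trmxC adjP.
have Pd := hermitian_spectral_diag_real Ph.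
have /orthomx_spectralP := hermitian_normalmx Ph.
have UU := spectral_unitarymx P; set U := spectralmx P in UU *.
set d := spectral_diag P in Pd *; rewrite invmx_unitary // -adj_trmxC => PE.
have UadjU : U *m adj U = 1%:M by rewrite adj_trmxC; apply/unitarymxP.
have UPU : U *m P *m adj U = diag_mx d.
  by rewrite PE !mulmxA UadjU mul1mx -mulmxA UadjU mulmx1.
have d_ge0 i : exists2 r : R, 0 <= r & d ord0 i = r%:C.
  pose v := adj U *m delta_mx i (ord0 : 'I_1).
  exists (vsq v - vsq (N *m v)).
    by rewrite subr_ge0; have := N1 v; rewrite mul1r.
  have : adj v *m P *m v = ((vsq v - vsq (N *m v))%:C)%:M.
    rewrite /P mulmxBr mulmx1 mulmxBl vsq_adj -vsq_mul.
    by rewrite -raddfB -rmorphB.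
  rewrite /v adj_mul adjK -!mulmxA (mulmxA U) (mulmxA (U *m P)) UPU.
  move=> /matrixP/(_ ord0 ord0); rewrite [RHS]mxE mulr1n => <-.
  have -> : adj (delta_mx i ord0 : 'cV[C]_q) = delta_mx ord0 i.
    apply/matrixP => a b; rewrite adjE !mxE andbC.
    by case: (_ && _); rewrite ?rmorph1 ?rmorph0.
  by rewrite -rowE -colE !mxE eqxx mulr1n.
pose e : 'rV[C]_q := \row_i (Num.sqrt (complex.Re (d ord0 i)))%:C.
exists (diag_mx e *m U).
have ee : adj (diag_mx e) *m diag_mx e = diag_mx d.
  have -> : adj (diag_mx e) = diag_mx e.
    apply/matrixP => a b; rewrite adjE !mxE eq_sym.
    by case: eqP => [->|_]; rewrite ?mulr1n ?mulr0n ?conjc_real ?rmorph0.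
  rewrite mulmx_diag; congr diag_mx; apply/rowP => a; rewrite !mxE.
  have [r r0 ->] := d_ge0 a; rewrite /= -rmorphM -expr2 sqr_sqrtr //.
by rewrite adj_mul mulmxA -(mulmxA (adj U)) ee PE.
Qed.

End Psd.

Section Assembly.
Context {R : realType} {X : topologicalType} {n : nat}.
Variable A : set (X -> R[i]).
Local Notation C := R[i].
Local Notation Y := (X * 'I_n)%type.
Local Notation kernel := (Y -> Y -> C).
Hypothesis uA : unital_subalgebra A.
Hypothesis mA : modulus_approx A.
Local Notation rowA := (@rowA R X n A).
Local Notation posk := (@posk R X n A).

Variables (J : nat) (phi : 'I_J -> X -> R) (c c' : 'I_J -> X -> C) (e : R).
Hypothesis J_gt0 : (0 < J)%N.
Hypothesis e_gt0 : 0 < e.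
Hypothesis e_le1 : e <= 1.
Hypothesis phi_ge0 : forall j x, 0 <= phi j x.
Hypothesis phi_sum : forall x, \sum_j phi j x = 1.
Hypothesis Ac : forall j, A (c j).
Hypothesis Ac' : forall j, A (c' j).
Hypothesis cc' : forall j x, c j x * c' j x = 1.
Hypothesis hc : forall j x,
  1 + e * phi j x <= sqn (c j x) <= 1 + e * phi j x + e ^+ 2.

Variables (M d : R).
Hypothesis M_ge1 : 1 <= M.
Hypothesis d_ge0 : 0 <= d.

Let tau : R := 6 * d + 20 * M * J%:R * e.

Section Polarization.
Variables (f : X -> C) (y : 'I_J -> C).
Hypothesis Af : A f.
Hypothesis fM : forall x, sqn (f x) <= M ^+ 2.
Hypothesis yM : forall j, sqn (y j) <= M ^+ 2.
Hypothesis fy : forall j x,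
  phi j x * Normc.normc (f x - y j) <= phi j x * d.

Let testk_twist w z : sqn w = 1 -> rowA z ->
  posk (\sum_j scalek (2 * complex.Re (w * y j)) (testk c j z)
    + scalek (2 * e * tau) (sqk z)
    - scalek e (crossk z (actr (fun x => w * f x) z))).
Proof.
move=> w1 Az.
apply: (testk_upper uA mA J_gt0 e_gt0 e_le1 phi_ge0 phi_sum Ac Ac' cc' hc
  (alg_scale uA w Af) M_ge1 _ _ d_ge0 _ Az).
- by move=> x; rewrite sqnM w1 mul1r.
- by move=> j; rewrite sqnM w1 mul1r.
move=> j x; rewrite mulrDr -lerBlDl -mulrBr; apply: le_trans (fy j x).
rewrite ler_wpM2l //; apply: (@le_trans _ _ (Normc.normc (w * (f x - y j)))).
  rewrite -raddfB -mulrBr; exact: le_trans (ler_norm _) (normc_Re _).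
rewrite Normc.normcM -[leRHS]mul1r ler_wpM2r //.
  by case: (f x - y j) => p q; exact: sqrtr_ge0.
by rewrite -(@expr_le1 _ 2) ?normc_sqr ?w1 //; case: (w) => p q; exact: sqrtr_ge0.
Qed.

(** The four twists of the previous estimate by fourth roots of unity add up to
    its sesquilinear form. *)
Lemma testk_polarization h g : rowA h -> rowA g ->
  posk (\sum_j (crossk (actr (c j) g) (fun u => y j * actr (c j) h u)
                - crossk g (fun u => y j * h u))
    + scalek (2 * e * tau) (sqk h + sqk g)
    - scalek e (crossk g (actr f h))).
Proof.
move=> Ah Ag.
have Az w : rowA (fun u => h u + w * g u)
  by exact: (rowA_add uA Ah (rowA_scale uA w Ag)).
have w1 : sqn (1 : C) = 1 by exact: sqn1.
have w2 : sqn (- 1 : C) = 1 by rewrite /sqn /=; ring.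
have w3 : sqn ('i%C : C) = 1 by rewrite /sqn /=; ring.
have w4 : sqn (- 'i%C : C) = 1 by rewrite /sqn /=; ring.
have H := posk_add (posk_add (testk_twist w1 (Az 1)) (testk_twist w2 (Az (- 1))))
  (posk_add (testk_twist w3 (Az 'i%C)) (testk_twist w4 (Az (- 'i%C)))).
have q0 : 0 <= 4^-1 :> R by rewrite invr_ge0 ler0n.
have := posk_scale uA q0 H; congr posk; apply/funext => u; apply/funext => v.
have ii : 'i%C * 'i%C = -1 :> C by rewrite -expr2 sqr_i.
have ci : ('i%C)^*%C = - 'i%C :> C by apply/eqP; rewrite eq_complex /= oppr0 !eqxx.
have c1 : (1 : C)^*%C = 1 by exact: rmorph1.
have ReE (z : C) : (2 * complex.Re z)%:C = z + z^*%C.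
  case: z => p q; apply/eqP; rewrite eq_complex /=.
  by apply/andP; split; apply/eqP; ring.
have four : 4 != 0 :> C by rewrite pnatr_eq0.
have T j : (\sum_(w <- [:: 1; -1; 'i%C; - 'i%C])
     (2 * complex.Re (w * y j))%:C * testk c j (fun u => h u + w * g u) u v)
   = 4 * (crossk (actr (c j) g) (fun u => y j * actr (c j) h u)
                - crossk g (fun u => y j * h u)) u v.
  rewrite !big_cons big_nil !ReE !fctE /testk /crossk !fctE /sqk /actr.
  rewrite !(conjcM, conjcD, conjcN, c1, ci).
  move: ii; move: ('i%C : C) => I ii.
  ring: ii.
pose S w := \sum_j (2 * complex.Re (w * y j))%:C * testk c j (fun u => h u + w * g u) u v.
have TS : S 1 + S (-1) + (S 'i%C + S (- 'i%C)) =
   4 * \sum_j (crossk (actr (c j) g) (fun u => y j * actr (c j) h u)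
                - crossk g (fun u => y j * h u)) u v.
  rewrite /S mulr_sumr -!big_split; apply: eq_bigr => j _ /=.
  by rewrite -T !big_cons big_nil addr0 !addrA.
pose cr w := crossk (fun u => h u + w * g u)
  (actr (fun x => w * f x) (fun u => h u + w * g u)) u v.
have crS : cr 1 + cr (-1) + (cr 'i%C + cr (- 'i%C)) = 4 * crossk g (actr f h) u v.
  rewrite /cr /crossk /actr !(conjcM, conjcD, conjcN, c1, ci).
  by move: ii; move: ('i%C : C) => I ii; ring: ii.
pose q w := sqk (fun u => h u + w * g u) u v.
have qS : q 1 + q (-1) + (q 'i%C + q (- 'i%C)) = 4 * (sqk h u v + sqk g u v).
  rewrite /q /sqk !(conjcM, conjcD, conjcN, c1, ci).
  by move: ii; move: ('i%C : C) => I ii; ring: ii.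
rewrite /scalek !fctE !fct_sumE fmorphV rmorph_nat.
rewrite -/(S 1) -/(S (-1)) -/(S 'i%C) -/(S (- 'i%C)).
rewrite -/(cr 1) -/(cr (-1)) -/(cr 'i%C) -/(cr (- 'i%C)).
rewrite -/(q 1) -/(q (-1)) -/(q 'i%C) -/(q (- 'i%C)).
have quarter a b : a = 4 * b -> b = 4^-1 * a :> C by move=> ->; rewrite mulKf.
by rewrite (quarter _ _ TS) (quarter _ _ crS) (quarter _ _ qS); ring.
Qed.

End Polarization.

Definition lincomb {m p} (W : 'M[C]_(p, m)) (h : 'I_m -> Y -> C) (k : 'I_p) : Y -> C :=
  fun u => \sum_b W k b * h b u.

Lemma rowA_lincomb m p (W : 'M[C]_(p, m)) h k :
  (forall b, rowA (h b)) -> rowA (lincomb W h k).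
Proof. by move=> Ah; apply: rowA_sum => // b; exact: rowA_scale. Qed.

Lemma actr_lincomb (a : X -> C) m p (W : 'M[C]_(p, m)) h k :
  actr a (lincomb W h k) = lincomb W (fun b => actr a (h b)) k.
Proof.
apply/funext => u; rewrite /actr /lincomb mulr_sumr.
by apply: eq_bigr => b _; rewrite mulrCA.
Qed.

Lemma sqk_lincomb m p (W : 'M[C]_(p, m)) (h : 'I_m -> Y -> C) u v :
  \sum_k sqk (lincomb W h k) u v
  = (adj (\col_b h b u) *m (adj W *m W) *m (\col_b h b v)) ord0 ord0.
Proof.
have -> : adj (\col_b h b u) *m (adj W *m W) *m (\col_b h b v)
    = adj (W *m \col_b h b u) *m (W *m \col_b h b v) by rewrite adj_mul !mulmxA.
rewrite adj_mulE; apply: eq_bigr => k _; rewrite /sqk /lincomb !mxE.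
by congr (_^*%C * _); apply: eq_bigr => b _; rewrite mxE.
Qed.

Lemma sqk_defect m p (D : 'M[C]_m) (N : 'M[C]_(p, m)) (h : 'I_m -> Y -> C) u v :
  adj D *m D = 1%:M - adj N *m N ->
  \sum_k sqk (lincomb D h k) u v + \sum_k sqk (lincomb N h k) u v
  = \sum_b sqk (h b) u v.
Proof.
have mxB (P Q : 'M[C]_1) : (P - Q) ord0 ord0 = P ord0 ord0 - Q ord0 ord0.
  by rewrite !mxE.
move=> DN; rewrite !sqk_lincomb DN mulmxBr mulmxBl mulmx1 mxB subrK adj_mulE.
by apply: eq_bigr => b _; rewrite !mxE.
Qed.

Lemma crossk_sum (I : Type) (r : seq I) (z : Y -> C) (w : I -> Y -> C) u v :
  \sum_(i <- r) crossk z (w i) u v = crossk z (fun t => \sum_(i <- r) w i t) u v.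
Proof.
by rewrite /crossk big_split /= -mulr_sumr -mulr_suml rmorph_sum.
Qed.

Let cross j a b (z w : 'I_n -> Y -> C) (N : 'I_J -> 'M[C]_n) : kernel :=
  crossk (actr (c j) (z a)) (fun u => N j a b * actr (c j) (w b) u)
  - crossk (z a) (fun u => N j a b * w b u).

(** Complete the square: the difference is the form at the vectors [z - N w] plus
    the form at [D w], where [D] is the square root of [1 - N^* N]. *)
Lemma testk_contraction (N : 'I_J -> 'M[C]_n) (z w : 'I_n -> Y -> C) j :
  bounded_by 1 (N j) -> (forall a, rowA (z a)) -> (forall b, rowA (w b)) ->
  posk (\sum_a testk c j (z a) + \sum_b testk c j (w b)
        - \sum_a \sum_b cross j a b z w N).
Proof.
move=> N1 Az Aw; have [D DN] := contraction_defect N1.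
have T0 t : rowA t -> posk (testk c j t).
  exact: (testk_ge0 uA e_gt0 phi_ge0 Ac Ac' cc' hc).
pose t a u := z a u + (-1) * lincomb (N j) w a u.
have At a : rowA (t a).
  exact: (rowA_add uA (Az a) (rowA_scale uA _ (rowA_lincomb _ _ Aw))).
have := posk_add (posk_sum (index_enum 'I_n) (fun a => T0 _ (At a)))
  (posk_sum (index_enum 'I_n) (fun k => T0 _ (rowA_lincomb D k Aw))).
congr posk; apply/funext => u; apply/funext => v.
rewrite !fctE !fct_sumE.
have -> : \sum_k testk c j (lincomb D w k) u v =
    \sum_b testk c j (w b) u v - \sum_a testk c j (lincomb (N j) w a) u v.
  rewrite /testk !big_split /= !sumrN.
  under eq_bigr => k _ do rewrite actr_lincomb.
  under [X in _ = _ - (X - _)]eq_bigr => k _ do rewrite actr_lincomb.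
  rewrite -(sqk_defect w u v DN).
  by rewrite -(sqk_defect (fun b => actr (c j) (w b)) u v DN); ring.
have -> : \sum_a (\sum_b cross j a b z w N) u v =
    \sum_a (crossk (actr (c j) (z a)) (actr (c j) (lincomb (N j) w a))
      - crossk (z a) (lincomb (N j) w a)) u v.
  apply: eq_bigr => a _.
  by rewrite !fct_sumE actr_lincomb !fctE /lincomb -!crossk_sum -sumrB.
rewrite addrCA [RHS]addrAC [RHS]addrC; congr (_ + _).
rewrite -!sumrB; apply: eq_bigr => a _.
rewrite !fctE /testk !fctE /sqk /crossk /actr /t.
rewrite !(conjcM, conjcD, conjcN) rmorph1; ring.
Qed.

Variables (F : 'M[X -> C]_n) (N : 'I_J -> 'M[C]_n).
Hypothesis AF : forall a b, A (F a b).
Hypothesis FM : forall a b x, sqn (F a b x) <= M ^+ 2.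
Hypothesis NM : forall j a b, sqn (N j a b) <= M ^+ 2.
Hypothesis FN : forall j x a b,
  phi j x * Normc.normc (F a b x - N j a b) <= phi j x * d.
Hypothesis N1 : forall j, bounded_by 1 (N j).

(** With [xi] the rows of [F] and [eta] the unit rows, [sum_b F a b eta b = xi a], so
    the polarized estimate bounds [2 e sum_a |xi a|^2] by the values of the test
    forms, those by contractivity of the [N j] by [sum_j T_j] at the [xi] and at the
    [eta], and these by [e] times the squares. *)
Lemma posk_matrix_estimate (r : R) : r = 2 * J%:R * e + 2 * tau * n%:R ->
  posk (scalek (1 + r) (gram F + @unitk R X n) - scalek 2 (gram F)).
Proof.
move=> rE; pose xi a : Y -> C := fun u => F a u.2 u.1.
pose eta b : Y -> C := fun u => (u.2 == b)%:R.
have Axi a : rowA (xi a) by move=> b; exact: AF.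
have Aeta b : rowA (eta b) by exact: rowA_unit.
have K1 := posk_sum (index_enum 'I_n) (fun a => posk_sum (index_enum 'I_n) (fun b =>
  testk_polarization (AF a b) (FM a b) (fun j => NM j a b) (fun j x => FN j x a b)
    (Aeta b) (Axi a))).
have K2 := posk_sum (index_enum 'I_J) (fun j => testk_contraction (N1 j) Axi Aeta).
have H z (Az : rowA z) := testk_sum uA mA J_gt0 e_gt0 phi_sum Ac hc Az.
have K3 := posk_sum (index_enum 'I_n) (fun a => H _ (Axi a)).
have K4 := posk_sum (index_enum 'I_n) (fun a => H _ (Aeta a)).
have e1 : 0 <= e^-1 by rewrite invr_ge0 ltW.
set k1 := (X in posk X) in K1; set k2 := (X in posk X) in K2.
set k3 := (X in posk X) in K3; set k4 := (X in posk X) in K4.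
have := posk_scale uA e1 (posk_add (posk_add K1 K2) (posk_add K3 K4)).
congr posk; rewrite gram_sum unitk_sum; apply/funext => u; apply/funext => v.
pose Q := \sum_a sqk (xi a) u v; pose P := \sum_b sqk (eta b) u v.
pose Tx := \sum_a \sum_j testk c j (xi a) u v.
pose Te := \sum_a \sum_j testk c j (eta a) u v.
pose Z := \sum_a \sum_b \sum_j cross j a b xi eta N u v.
have E3 : k3 u v = (e * (1 + 2 * J%:R * e))%:C * Q - Tx.
  rewrite /k3 !fct_sumE /Q /Tx mulr_sumr -sumrB; apply: eq_bigr => a _.
  by rewrite !fctE !fct_sumE.
have E4 : k4 u v = (e * (1 + 2 * J%:R * e))%:C * P - Te.
  rewrite /k4 !fct_sumE /P /Te mulr_sumr -sumrB; apply: eq_bigr => a _.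
  by rewrite !fctE !fct_sumE.
have E2 : k2 u v = Tx + Te - Z.
  have -> : Tx = \sum_j \sum_a testk c j (xi a) u v by exact: exchange_big.
  have -> : Te = \sum_j \sum_a testk c j (eta a) u v by exact: exchange_big.
  have -> : Z = \sum_j \sum_a \sum_b cross j a b xi eta N u v.
    rewrite [RHS]exchange_big; apply: eq_bigr => a _; exact: exchange_big.
  rewrite /k2 !fct_sumE -big_split -sumrB; apply: eq_bigr => j _ /=.
  rewrite !fctE !fct_sumE; congr (_ - _); apply: eq_bigr => a _.
  by rewrite !fct_sumE.
have xiE a : (fun t => \sum_b actr (F a b) (eta b) t) = xi a.
  apply/funext => t; rewrite (bigD1 t.2) //= big1.
    by rewrite /actr /eta eqxx mulr1 addr0.
  by move=> b /negPf tb; rewrite /actr /eta eq_sym tb mulr0.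
have E1 : k1 u v = Z + (2 * e * tau)%:C * (n%:R * (P + Q)) - e%:C * (2 * Q).
  have -> : n%:R * (P + Q) = \sum_a \sum_b (sqk (eta b) u v + sqk (xi a) u v).
    under eq_bigr => a _ do rewrite big_split sumr_const card_ord /=.
    by rewrite big_split sumr_const card_ord /= sumrMnl -mulrnDl mulr_natl.
  have -> : 2 * Q = \sum_a \sum_b crossk (xi a) (actr (F a b) (eta b)) u v.
    rewrite /Q mulr_sumr; apply: eq_bigr => a _.
    by rewrite crossk_sum xiE /crossk /sqk; ring.
  rewrite /k1 !fct_sumE /Z !mulr_sumr -big_split -sumrB; apply: eq_bigr => a _.
  rewrite !fct_sumE !mulr_sumr -big_split -sumrB; apply: eq_bigr => b _ /=.
  by rewrite !fctE !fct_sumE.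
have -> : (scalek e^-1 (k1 + k2 + (k3 + k4))) u v
    = (e^-1)%:C * (k1 u v + k2 u v + (k3 u v + k4 u v)) by [].
rewrite E1 E2 E3 E4 /scalek !fctE !fct_sumE -/Q -/P.
rewrite rE {E1 E2 E3 E4 K1 K2 K3 K4 xiE}.
have eC : e%:C != 0 :> C.
  by rewrite -(rmorph0 (real_complex R)) (inj_eq (@complexI R)) gt_eqF.
rewrite !(rmorphM, rmorphD, fmorphV, rmorph_nat, rmorph1).
by field.
Qed.

End Assembly.

(** * Partitions of unity subordinate to a family of functions *)

Section Partition.
Context {R : realType} {X : topologicalType}.
Local Notation C := R[i].

Lemma normc_ge0 (z : C) : 0 <= Normc.normc z.
Proof. by case: z => p q; exact: sqrtr_ge0. Qed.

Lemma normc_triangle (z w : C) : Normc.normc (z + w) <= Normc.normc z + Normc.normc w.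
Proof. by have := ler_normD z w; rewrite !normE -rmorphD lecR. Qed.

Lemma normc_distD (z w : C) :
  `|Normc.normc z - Normc.normc w| <= Normc.normc (z - w).
Proof.
have NE (x : C) : Normc.normc (- x) = Normc.normc x by case: x => p q /=; rewrite !sqrrN.
have h1 := normc_triangle (z - w) w; have h2 := normc_triangle (w - z) z.
rewrite subrK in h1; rewrite subrK -opprB NE in h2.
by rewrite ler_norml; apply/andP; split; lra.
Qed.

Lemma continuous_normc_sub (f : X -> C) (a : C) :
  continuous (f : X -> C^o) -> continuous (fun x => Normc.normc (f x - a)).
Proof.
move=> cf; apply: (@continuous_part _ _ (fun z => Normc.normc (z - a))) => // z w.
apply: le_trans (normc_distD _ _) _; by rewrite opprB addrA subrK.
Qed.

Lemma continuous_sum (I : Type) (r : seq I) (f : I -> X -> R) :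
  (forall i, continuous (f i)) -> continuous (fun x => \sum_(i <- r) f i x).
Proof.
move=> cf; elim: r => [|i r IH] x.
  rewrite (_ : (fun x => _) = fun=> 0); first exact: cvg_cst.
  by apply/funext => y; rewrite big_nil.
rewrite (_ : (fun x => _) = fun x => f i x + \sum_(j <- r) f j x).
  by apply: cvgD; [exact: cf|exact: IH].
by apply/funext => y; rewrite big_cons.
Qed.

(** Bumps in the distance between the values of the [g k], normalized by their sum;
    compactness makes finitely many of them cover [X]. *)
Lemma partition_of_unity (K : finType) (g : K -> X -> C) (d : R) :
  compact [set: X] -> (forall k, continuous (g k : X -> C^o)) -> 0 < d ->
  (exists x : X, True) ->
  exists J (p : 'I_J -> X) (phi : 'I_J -> X -> R),
    [/\ (0 < J)%N, forall j, continuous (phi j), forall j x, 0 <= phi j x,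
      forall x, \sum_j phi j x = 1 &
      forall j x k, phi j x * Normc.normc (g k x - g k (p j)) <= phi j x * d].
Proof.
move=> cX cg d0 [x0 _].
pose dist y x : R := \sum_k Normc.normc (g k x - g k y).
have cdist y : continuous (dist y).
  by apply: continuous_sum => k; exact: continuous_normc_sub.
have dist0 y : dist y y = 0.
  by rewrite /dist big1 // => k _; rewrite subrr Normc.normc0.
have dist_ge k y x : Normc.normc (g k x - g k y) <= dist y x.
  rewrite /dist (bigD1 k) //= lerDl; apply: sumr_ge0 => i _; exact: normc_ge0.
have [s scov] : exists s : seq X, forall x, exists2 y, y \in s & dist y x < d.
  (* Finite sets of centres, ordered by inclusion. *)
  have FF : Filter [set S : set (seq X) |
      exists s0 : seq X, forall s : seq X, {subset s0 <= s} -> S s].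
    split=> [|P Q [s hs] [t ht]|P Q PQ [s hs]]; first by exists [::].
      exists (s ++ t) => r sr; split; [apply: hs|apply: ht] => x xs;
        by apply: sr; rewrite mem_cat xs ?orbT.
    by exists s => r sr; exact/PQ/hs.
  have := (compact_near_coveringP [set: X]).1 cX _ _
    (fun (s : seq X) x => exists2 y, y \in s & dist y x < d) FF.
  case=> [y _|s hs]; last by exists s => x; exact: (hs s).
  exists ([set x | dist y x < d], [set s : seq X | y \in s]); last first.
    by move=> [x s] /= [yx ys]; exists y.
  split => /=; last by exists [:: y] => s; apply; rewrite inE.
  have /cvgrPdist_lt/(_ d d0) := cdist y y.
  apply: filterS => x; rewrite dist0 sub0r normrN; exact: le_lt_trans (ler_norm _).
have sz : (0 < size s)%N by have [y] := scov x0; case: (s).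
pose p (j : 'I_(size s)) := nth x0 s j.
pose t j x := d - dist (p j) x.
(* Twice the positive part of [t j]. *)
pose w j x := t j x + `|t j x|.
have ct j : continuous (t j).
  by move=> x; apply: cvgB; [exact: cvg_cst|exact: cdist].
have cw j : continuous (w j).
  by move=> x; apply: cvgD; [exact: ct|apply: cvg_norm; exact: ct].
have w0 j x : 0 <= w j x.
  by rewrite /w -lerBlDl sub0r; have := ler_norm (- t j x); rewrite normrN.
pose W x := \sum_j w j x.
have W0 x : 0 < W x.
  have [y ys yx] := scov x.
  have hj : (index y s < size s)%N by rewrite index_mem.
  rewrite /W (bigD1 (Ordinal hj)) //= ltr_pwDl ?sumr_ge0 //.
  have tp : 0 < t (Ordinal hj) x by rewrite /t /p /= nth_index // subr_gt0.
  by rewrite /w addr_gt0 // normr_gt0 gt_eqF.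
have cW : continuous W by apply: continuous_sum.
exists (size s), p, (fun j x => w j x / W x); split => //.
- move=> j x; apply: cvgM; first exact: cw.
  by apply: cvgV; [rewrite gt_eqF|exact: cW].
- by move=> j x; rewrite divr_ge0 // ltW.
- by move=> x; rewrite -mulr_suml -/(W x) mulfV ?(gt_eqF (W0 x)).
move=> j x k; have [tp|tn] := ltP 0 (t j x).
  rewrite ler_wpM2l ?divr_ge0 ?(ltW (W0 x)) //.
  by apply: (le_trans (dist_ge k (p j) x)); rewrite -subr_ge0; exact: ltW tp.
have -> : w j x = 0 by rewrite /w ler0_norm // subrr.
by rewrite !mul0r.
Qed.

End Partition.

(** * Pointwise contractivity *)

Section Pointwise.
Context {R : realType}.
Local Notation C := R[i].

Lemma l2norm_le1 n (v : 'cV[C]_n) : (l2norm v <= 1) = (vsq v <= 1).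
Proof. by rewrite l2norm_sqr -[in LHS](sqrtr1 R) ler_psqrt ?nnegrE ?vsq_ge0. Qed.

Lemma l2norm_mul_le p q (M : 'M[C]_(p, q)) (K : R) v :
  (forall i j, Normc.normc (M i j) <= K) -> l2norm v <= 1 ->
  l2norm (M *m v) <= Num.sqrt (p%:R * (q%:R * K) ^+ 2).
Proof.
move=> MK; rewrite l2norm_le1 => v1; rewrite l2norm_sqr ler_wsqrtr //.
have vj j : Normc.normc (v j ord0) <= 1.
  rewrite -(@expr_le1 _ 2) ?normc_ge0 // normc_sqr; apply: le_trans v1.
  by rewrite /vsq (bigD1 j) //= lerDl sumr_ge0 // => i _; exact: sqn_ge0.
have row i : Normc.normc ((M *m v) i ord0) <= q%:R * K.
  rewrite mxE -lecR -normE; apply: (le_trans (ler_norm_sum _ _ _)).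
  apply: (@le_trans _ _ (\sum_(j < q) K%:C)); last first.
    by rewrite sumr_const card_ord -[leLHS]mulr_natl rmorphM rmorph_nat.
  apply: ler_sum => j _; rewrite normE lecR Normc.normcM.
  by apply: le_trans (MK i j); rewrite ler_piMr ?normc_ge0.
apply: (@le_trans _ _ (\sum_(i < p) (q%:R * K) ^+ 2)); last first.
  by rewrite sumr_const card_ord -[leLHS]mulr_natl.
apply: ler_sum => i _; rewrite -normc_sqr ler_pXn2r ?nnegrE ?normc_ge0 //.
exact: le_trans (normc_ge0 _) (row i).
Qed.

Lemma opnorm_bounded p q (M : 'M[C]_(p, q)) (K : R) :
  (forall i j, Normc.normc (M i j) <= K) ->
  opnorm M <= Num.sqrt (p%:R * (q%:R * K) ^+ 2).
Proof.
move=> MK; apply: ge_sup.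
  by exists (l2norm (M *m 0)); exists 0 => //=; rewrite l2norm_le1 vsq0.
by move=> _ [v /= v1 <-]; exact: l2norm_mul_le.
Qed.

Lemma opnorm_bounded_by p q (M : 'M[C]_(p, q)) : bounded_by (opnorm M ^+ 2) M.
Proof.
have [K MK] : exists K, forall i j, Normc.normc (M i j) <= K.
  exists (\sum_i \sum_j Normc.normc (M i j)) => i j.
  rewrite (bigD1 i) //= (bigD1 j) //= -addrA lerDl addr_ge0 ?sumr_ge0 // => k _.
    exact: normc_ge0.
  by rewrite sumr_ge0 // => l _; exact: normc_ge0.
have ub w : vsq w <= 1 -> Num.sqrt (vsq (M *m w)) <= opnorm M.
  move=> w1; rewrite -l2norm_sqr; apply: ub_le_sup.
    exists (Num.sqrt (p%:R * (q%:R * K) ^+ 2)) => _ [v /= v1 <-].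
    exact: l2norm_mul_le.
  by exists w => //=; rewrite l2norm_le1.
move=> v; have [v0|v0] := eqVneq (vsq v) 0.
  by rewrite (vsq_eq0 v0) mulmx0 !vsq0 mulr0.
have vp : 0 < vsq v by rewrite lt_def v0 vsq_ge0.
pose s := Num.sqrt (vsq v); have s2 : s ^+ 2 = vsq v by rewrite sqr_sqrtr ?vsq_ge0.
have s0 : s != 0 by rewrite gt_eqF // sqrtr_gt0.
pose w := (s^-1)%:C *: v.
have w1 : vsq w <= 1 by rewrite vsqZ sqnR exprVn s2 mulVf.
have vE : v = s%:C *: w by rewrite scalerA -rmorphM mulfV // scale1r.
have h : vsq (M *m w) <= opnorm M ^+ 2.
  rewrite -(sqr_sqrtr (vsq_ge0 (M *m w))) ler_pXn2r ?nnegrE ?sqrtr_ge0 ?ub //.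
  exact: le_trans (sqrtr_ge0 _) (ub _ w1).
have w1' : vsq w = 1 by rewrite vsqZ sqnR exprVn s2 mulVf.
clearbody w; rewrite vE -scalemxAr !vsqZ w1' mulr1 [leRHS]mulrC.
by rewrite ler_wpM2l ?sqn_ge0.
Qed.

End Pointwise.

Section Factorization.
Context {R : realType} {X : topologicalType} {n : nat}.
Variable A : set (X -> R[i]).
Local Notation C := R[i].
Hypothesis cX : compact [set: X].

Section Algebra.
Hypothesis uA : unital_subalgebra A.

Lemma alg_continuous f : A f -> continuous (f : X -> C^o).
Proof. by case: uA => + _ _ _; exact. Qed.

Lemma alg_bounded f : A f -> exists2 M : R, 0 <= M & forall x, sqn (f x) <= M.
Proof. by move=> Af; exact/continuous_bounded/alg_continuous_sqn/Af. Qed.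

Lemma matrix_bounded (F : 'M[X -> C]_n) : (forall i j, A (F i j)) ->
  exists2 M : R, 1 <= M & forall i j x, sqn (F i j x) <= M ^+ 2.
Proof.
move=> AF.
have hB i j : exists M : R, 0 <= M /\ forall x, sqn (F i j x) <= M.
  by have [M M0 hM] := alg_bounded (AF i j); exists M.
pose B i j := projT1 (cid (hB i j)).
have B0 i j : 0 <= B i j by rewrite /B; case: cid => M [].
have BF i j x : sqn (F i j x) <= B i j by rewrite /B; case: cid => M [].
have S0 : 0 <= \sum_i \sum_j B i j by apply: sumr_ge0 => i _; exact: sumr_ge0.
exists (1 + \sum_i \sum_j B i j); first by rewrite lerDl.
move=> i j x; apply: (@le_trans _ _ (1 + \sum_i \sum_j B i j)); last first.
  by rewrite expr2 ler_peMl ?addr_ge0 // lerDl.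
apply: (le_trans (BF i j x)); rewrite ler_wpDl // (bigD1 i) //= (bigD1 j) //=.
by rewrite -addrA lerDl addr_ge0 ?sumr_ge0 // => k _; exact: sumr_ge0.
Qed.

Lemma mxball_contraction (F : 'M[X -> C]_n) : mxball A F ->
  exists t : R, [/\ 0 < t, t < 1 & forall x, bounded_by (t ^+ 2) (evmx x F)].
Proof.
move=> [AF F1]; have [M M1 FM] := matrix_bounded AF.
have nF x i j : Normc.normc (evmx x F i j) <= M.
  rewrite mxE -(@ler_pXn2r _ 2) ?nnegrE ?normc_ge0 ?(le_trans ler01) //.
  by rewrite normc_sqr FM.
have ub x : opnorm (evmx x F) <= mxnorm F.
  apply: ub_le_sup; last by exists x.
  exists (Num.sqrt (n%:R * (n%:R * M) ^+ 2)) => _ [y _ <-].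
  exact: (opnorm_bounded (nF y)).
pose t := Num.max (1 / 2) (mxnorm F).
exists t; split.
- by rewrite lt_max; apply/orP; left; lra.
- by rewrite gt_max F1 andbT; lra.
move=> x; apply: bounded_by_le (opnorm_bounded_by _).
have o0 : 0 <= opnorm (evmx x F).
  apply: ub_le_sup; last first.
    by exists 0; rewrite /= ?mulmx0 l2norm_sqr vsq0 sqrtr0.
  exists (Num.sqrt (n%:R * (n%:R * M) ^+ 2)) => _ [v /= v1 <-].
  exact: (l2norm_mul_le (nF x) v1).
rewrite ler_pXn2r ?nnegrE // ?(le_trans o0) // le_max ub ?orbT //.
Qed.

End Algebra.

Hypothesis lA : logmodular A.
Let uA : unital_subalgebra A := lA.1.
Let mA : modulus_approx A := logmodular_modulus_approx lA.

(** The choice of parameters: [d] bounds the oscillation of [F] on the pieces of the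
    partition, and [e] is taken small with respect to the number [J] of pieces. *)
Lemma posk_of_contraction (F : 'M[X -> C]_n) (r : R) :
  (exists x : X, True) -> (forall i j, A (F i j)) ->
  (forall x, bounded_by 1 (evmx x F)) -> 0 < r ->
  posk A (scalek (1 + r) (gram F + @unitk R X n) - scalek 2 (gram F)).
Proof.
move=> X0 AF F1 r0; have [M M1 FM] := matrix_bounded uA AF.
have M0 : 0 < M by exact: lt_le_trans M1.
pose m : R := n%:R + 1.
have m0 : 0 < m by rewrite /m ltr_wpDl.
pose d := r / (24 * m).
have d0 : 0 < d by rewrite divr_gt0 // mulr_gt0.
have cF (k : 'I_n * 'I_n) : continuous (F k.1 k.2 : X -> C^o).
  exact: (alg_continuous uA (AF _ _)).
have [J [p [phi [J0 cphi phi0 phi1 phiF]]]] := partition_of_unity cX cF d0 X0.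
have J1 : 1 <= J%:R :> R by rewrite ler1n.
have J0' : 0 < J%:R :> R by exact: lt_le_trans J1.
pose w := J%:R * (2 + 40 * M * m).
have w0 : 0 < w by rewrite mulr_gt0 // addr_gt0 ?mulr_gt0.
pose e := Num.min 1 (r / (2 * w)).
have e0 : 0 < e by rewrite lt_min ltr01 divr_gt0 // mulr_gt0.
have e1 : e <= 1 by rewrite ge_min lexx.
have ew : e * w <= r / 2.
  have : e <= r / (2 * w) by rewrite ge_min lexx orbT.
  rewrite -(ler_pM2r w0); congr (_ <= _); field; rewrite gt_eqF //.
have approx j : exists cc : (X -> C) * (X -> C), [/\ A cc.1, A cc.2,
    forall x, cc.1 x * cc.2 x = 1 &
    forall x, 1 + e * phi j x <= sqn (cc.1 x) <= 1 + e * phi j x + e ^+ 2].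
  have phi_le1 x : phi j x <= 1.
    by rewrite -(phi1 x) (bigD1 j) //= lerDl sumr_ge0.
  have [|x|c [c' [Ac Ac' cc hc]]] := mA (v := fun x => 1 + e * phi j x) (B := 2)
      (e := e ^+ 2) _ _ (exprn_gt0 2 e0).
  - by move=> x; apply: cvgD; [exact: cvg_cst|apply: cvgM; [exact: cvg_cst|exact: cphi]].
  - have h : 0 <= e * phi j x by rewrite mulr_ge0 // ltW.
    have h' : e * phi j x <= 1 by rewrite mulr_ile1 // ltW.
    by apply/andP; split; lra.
  - by exists (c, c').
have [cc hcc] := choice approx.
pose r' := 2 * J%:R * e + 2 * (6 * d + 20 * M * J%:R * e) * n%:R.
have r'r : r' <= r.
  have -> : r' = 2 * J%:R * e + 12 * d * n%:R + 40 * M * J%:R * e * n%:R.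
    by rewrite /r'; ring.
  have h1 : 12 * d * n%:R <= r / 2.
    have : d * m = r / 24 by rewrite /d; field; rewrite gt_eqF.
    by rewrite /m mulrDr mulr1 => h; have := d0; lra.
  have h2 : 2 * J%:R * e + 40 * M * J%:R * e * n%:R <= e * w.
    have -> : e * w = 2 * J%:R * e + 40 * M * J%:R * e * n%:R + 40 * M * J%:R * e.
      by rewrite /w /m; ring.
    by rewrite lerDl !mulr_ge0 // ltW.
  by lra.
have := @posk_matrix_estimate R X n A uA mA J phi (fun j => (cc j).1) (fun j => (cc j).2) e
  J0 e0 e1 phi0 phi1 _ _ _ _ M d M1 (ltW d0) F (fun j => evmx (p j) F) AF FM _ _ _ r' erefl.
have h1 j : A (cc j).1 by case: (hcc j).
have h2 j : A (cc j).2 by case: (hcc j).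
have h3 j x : (cc j).1 x * (cc j).2 x = 1 by case: (hcc j).
have h4 j x : 1 + e * phi j x <= sqn ((cc j).1 x) <= 1 + e * phi j x + e ^+ 2.
  by case: (hcc j).
have h5 j a b : sqn (evmx (p j) F a b) <= M ^+ 2 by rewrite mxE.
have h6 j x a b : phi j x * Normc.normc (F a b x - evmx (p j) F a b) <= phi j x * d.
  by rewrite mxE; exact: (phiF j x (a, b)).
move=> /(_ h1 h2 h3 h4 h5 h6 (fun j => F1 (p j))) H.
have rr : 0 <= r - r' by rewrite subr_ge0.
have HF : posk A (gram F + @unitk R X n).
  apply: posk_add.
    by rewrite gram_sum; apply: posk_sum => k; apply: posk_sqk => b; exact: AF.
  by rewrite -[unitk]scale1k; exact: posk_unitk.
have := posk_add H (posk_scale uA rr HF); congr posk.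
rewrite addrAC -scalekDl; congr (scalek _ _ - _); ring.
Qed.

(** The estimate reads [(1 - r) gram F <= (1 + r) unitk]; the value of [r] makes
    [(1 + r) / (1 - r)] smaller than [s]. *)
Lemma good_of_contraction (F : 'M[X -> C]_n) (s : R) :
  (forall i j, A (F i j)) -> (forall x, bounded_by 1 (evmx x F)) -> 1 < s ->
  exists2 G, good A G & F = scalemxf (Num.sqrt s)%:C G.
Proof.
move=> AF F1 s1; case: (pselect (exists x : X, True)) => [X0|nX]; last first.
  exists (scalar_cst X 0).
    by apply: good_cst => v; rewrite mul0mx vsq0 mul1r vsq_ge0.
  by apply: evmx_inj => x; case: nX; exists x.
pose r := (s - 1) / (s + 3).
have sp : 0 < s + 3 by lra.
have r0 : 0 < r by rewrite divr_gt0 // subr_gt0.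
have rs : r * (s + 3) = s - 1 by rewrite /r divfK // gt_eqF.
have r1 : r < 1 by rewrite /r ltr_pdivrMr // mul1r; lra.
have r1' : 0 < 1 - r by rewrite subr_gt0.
have := posk_of_contraction X0 AF F1 r0.
have i0 : 0 <= (1 - r)^-1 by rewrite invr_ge0 ltW.
move=> /(posk_scale uA i0) H.
have {}H : posk A (scalek ((1 + r) / (1 - r)) (@unitk R X n) - gram F).
  move: H; congr posk; apply/funext => u; apply/funext => v.
  rewrite /scalek !fctE; set a := gram F u v; set b := @unitk R X n u v.
  have rC : (1 - r)%:C != 0 :> C.
    by rewrite -(rmorph0 (real_complex R)) (inj_eq (@complexI R)) gt_eqF.
  have -> : ((1 + r) / (1 - r))%:C = ((1 - r)%:C)^-1 * (1 + r)%:C :> C.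
    by rewrite rmorphM fmorphV mulrC.
  have -> : ((1 - r)^-1)%:C = ((1 - r)%:C)^-1 :> C by rewrite fmorphV.
  have rE : (1 + r)%:C = 2 - (1 - r)%:C :> C.
    by rewrite rmorphB rmorphD rmorph1; ring.
  have nE : (2 : R)%:C = 2 :> C by exact: rmorph_nat.
  by rewrite rE nE; move: rC; move: ((1 - r)%:C) => x xC; field.
apply: (good_of_posk uA (alg_bounded uA) AF _ _ H).
  by rewrite divr_ge0 ?ltW // addr_gt0.
rewrite ltr_pdivrMr //; nra.
Qed.

End Factorization.

Theorem theorem5p2 (R : realType) (X : topologicalType)
    (A : set (X -> R[i])) :
  compact [set: X] -> hausdorff_space X -> logmodular A ->
  forall (n : nat) (F : 'M[X -> R[i]]_n), mxball A F ->
  exists (m : nat) (r c : nat -> nat)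
         (C : forall k, 'M[R[i]]_(r k, c k))
         (D : forall k, 'M[X -> R[i]]_(c k, r k.+1))
         (szF : (r 0%N = n) * (c m = n)),
    [/\ (0 < m)%N,
        (forall k, (k <= m)%N -> opnorm (C k) < 1),
        (forall k, (k < m)%N -> block_diag A (D k))
      & F = castmx szF (alt_prod C D m)].
Proof.
move=> cX _ lA n F AF; have uA := lA.1.
have [t [t0 t1 Ft]] := mxball_contraction cX uA AF.
pose F' := scalemxf (t^-1)%:C F.
have AF' i j : A (F' i j) by rewrite scalemxf_entry; apply: alg_scale => //; case: AF.
have F'1 x : bounded_by 1 (evmx x F').
  have -> : 1 = sqn (t^-1)%:C * t ^+ 2 by rewrite sqnR exprVn mulVf // sqrf_eq0 gt_eqF.
  by rewrite evmxZ; exact: bounded_byZ.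
pose s := (1 + t ^- 2) / 2.
have t2 : 1 < t ^- 2 by rewrite invf_gt1 ?exprn_gt0 // expr_lt1 // ltW.
have s1 : 1 < s by rewrite /s; lra.
have [G gG FG] := good_of_contraction cX lA AF' F'1 s1.
have ts0 : 0 <= t * Num.sqrt s by rewrite mulr_ge0 ?sqrtr_ge0 // ltW.
have ts1 : t * Num.sqrt s < 1.
  rewrite -(@expr_lt1 _ 2) // exprMn sqr_sqrtr; last by rewrite ltW // (lt_trans ltr01).
  have -> : t ^+ 2 * s = (t ^+ 2 + 1) / 2.
    by rewrite /s; field; rewrite gt_eqF.
  have : t ^+ 2 < 1 by rewrite expr_lt1 // ltW.
  by lra.
have [m mG] := good_factorized uA gG ts0 ts1.
have {mG}mF : factorized A m.+1 F.
  have FF' : F = scalemxf t%:C F'.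
    rewrite scalemxfA (_ : t%:C * (t^-1)%:C = 1) ?scale1mxf //.
    by rewrite -rmorphM mulfV ?rmorph1 // gt_eqF.
  clearbody F'; have -> : F = scalemxf (t * Num.sqrt s)%:C G.
    by rewrite FF' FG scalemxfA; congr scalemxf; rewrite rmorphM.
  exact: factorized_pad.
have [r [c [C [D [szF [hC hD FE]]]]]] := factorized_alt_prod mF.
by exists m.+1, r, c, C, D, szF.
Qed.
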